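(* Fix $n\ge1$. Suppose we are given an arbitrary collection $\tilde p_{\star|\mathrm{GS}}$ of real numbers $\tilde p^{j_1,\ldots,j_r}_{\iota_1,\ldots,\iota_r}$ ($j_s\in\{1,\ldots,n\}$, $\iota_s\in\{0,1\}^n$) for those index sequences such that $$r\ge1,\qquad\forall s\ \ j_s\ne\min\{h:\iota_s(h)=1\},\qquad\sum_{s=1}^r\iota_s\ne(0,\ldots,0)$$ (the sum taken modulo $2$; no restriction on $j_s$ when $\iota_s=(0,\ldots,0)$). Then it yields a formal FQ orthogonalization procedure $\Psi$ satisfying (vL) and (vC), by the prescription $$\Psi(A)=(\mathrm{Ad}\exp E^{\langle1\rangle})(\mathrm{Ad}\exp E^{\langle2\rangle})(\mathrm{Ad}\exp E^{\langle3\rangle})\cdots\mathcal O^{\mathrm{GS}}(A),$$ where $Q=\mathcal O^{\mathrm{GS}}(A)$, $A=Q+R$, and $$E^{\langle r\rangle}=\sum_{\iota_1,\ldots,\iota_r\in\{0,1\}^n,\ j_1,\ldots,j_r\in\{1,\ldots,n\}}\tilde p^{j_1,\ldots,j_r}_{\iota_1,\ldots,\iota_r}\,(R/Q)^{\iota_1}_{j_1}\cdots(R/Q)^{\iota_r}_{j_r}$$ (summing over the allowed index sequences). This assignment gives a bijection between such data $\tilde p_{\star|\mathrm{GS}}$ and the formal FQ orthogonalization procedures satisfying (vL) and (vC). This leaves $(((n-1)2^n+1)^r-1)(1-2^{-n})$ real coefficients on the $r$th expansion level ($r\ge1$) to be chosen freely.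
   Context: Convenient algebra: a unital real algebra $\mathfrak A$ with a decreasing filtration $\mathfrak A=\mathfrak A^{(0)}\supset\mathfrak A^{(1)}\supset\cdots$, $\mathfrak A^{(i)}\mathfrak A^{(j)}\subset\mathfrak A^{(i+j)}$, complete and Hausdorff for the filtration, with all $\mathfrak A/\mathfrak A^{(i)}$ finite-dimensional. Homomorphisms are unital and filtration-preserving. Clifford system: $(Q_1,\ldots,Q_n)$ with $Q_iQ_j+Q_jQ_i=-2\delta_{ij}1$. For $Q^2=\pm1$: $R^0_Q=\frac12(R+Q^{-1}RQ)$, $R^1_Q=\frac12(R-Q^{-1}RQ)$; superscripts/subscripts are iterated. For a Clifford system $Q$, $R\in\mathfrak A^n$, $\iota\in\{0,1\}^n$: $(R/Q)^\iota_j=(R_jQ_j^{-1}){}^{\iota_1}_{Q_1}\cdots{}^{\iota_n}_{Q_n}$. For $X\in\mathfrak A^\star$ (units): $(\mathrm{Ad}\,X)(A_1,\ldots,A_n)=(XA_1X^{-1},\ldots,XA_nX^{-1})$. Multipower: $Q^\iota=Q_1^{\iota_1}\cdots Q_n^{\iota_n}$. A formal FQ operation $\Psi$ assigns to certain $n$-tuples from convenient algebras $\mathfrak A$ another $n$-tuple from $\mathfrak A$, such that: (Frm) $A$ is in the domain of $\Psi$ iff there is a Clifford system $Q$ with $A-Q\in(\mathfrak A^{(1)})^n$. (Nat) If $\Psi(A)=B$ and $\phi$ is a homomorphism, then $\Psi(\phi(A))=\phi(B)$ (componentwise), and the domain on $\mathfrak A\oplus\mathfrak B$ contains the product of the domains.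 (Formal analyticity) If $Q$ is a Clifford system and $R\in(\mathfrak A^{(1)})^n$, then $\Psi(Q+R)_k=\sum_{r\ge0}\sum\psi^{[k],j_1,\ldots,j_r}_{\iota_0,\ldots,\iota_r}Q^{\iota_0}R_{j_1}Q^{\iota_1}\cdots R_{j_r}Q^{\iota_r}$, with fixed real coefficients $\psi$ independent of $Q$ (inner sum over $\iota_s\in\{0,1\}^n$, $j_s\in\{1,\ldots,n\}$). It is a formal FQ orthogonalization procedure if its values are Clifford systems. (vC): $\Psi(Q)=Q$ for every Clifford system $Q$. (vL): if $\Psi(A_1,\ldots,A_n)=(B_1,\ldots,B_n)$ then $\Psi((-1)^{\iota_1}A_1,\ldots,(-1)^{\iota_n}A_n)=((-1)^{\iota_1}B_1,\ldots,(-1)^{\iota_n}B_n)$. $\mathcal O^{\mathrm{GS}}(A_1,\ldots,A_n)=(Q_1,\ldots,Q_n)$ with $Q_1=\mathrm{pol}\,A_1$, $Q_k=\mathrm{pol}((A_k){}^1_{Q_1}\cdots{}^1_{Q_{k-1}})$, where $\mathrm{pol}\,H=\int_0^{2\pi}\frac{H}{\cos^2t-H^2\sin^2t}\frac{dt}{2\pi}$. *)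

(* Defs.v *)
From HB Require Import structures.
From mathcomp Require Import all_boot all_order all_algebra.
From mathcomp Require Import all_classical all_reals all_analysis.

Set Implicit Arguments.
Unset Strict Implicit.
Unset Printing Implicit Defensive.

Import Order.TTheory GRing.Theory Num.Theory.
Local Open Scope classical_set_scope.
Local Open Scope ring_scope.

(* The last three fields say that the filtration is Hausdorff, complete, and
   has finite-dimensional quotients: the e_k span the carrier modulo filt i. *)
Record convAlg (R : realType) := ConvAlg {
  carrier :> algType R;
  filt : nat -> set carrier;
  filt_all : filt 0%N = setT;
  filt_decr : forall i, filt i.+1 `<=` filt i;
  filt_zero : forall i, filt i 0;
  filt_lin : forall i (a : R) x y, filt i x -> filt i y -> filt i (a *: x + y);
  filt_mul : forall i j x y, filt i x -> filt j y -> filt (i + j)%N (x * y);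
  filt_separated : forall x, (forall i, filt i x) -> x = 0;
  filt_complete : forall u : nat -> carrier,
    (forall i, exists N, forall m m',
       (N <= m)%N -> (N <= m')%N -> filt i (u m - u m')) ->
    exists l, forall i, exists N, forall m, (N <= m)%N -> filt i (u m - l);
  filt_findim : forall i, exists d (e : 'I_d -> carrier),
    forall x, exists c : 'I_d -> R, filt i (x - \sum_(k < d) c k *: e k)
}.

Section DirectSum.
Variables (R : realType) (A B : convAlg R).

Let dfilt (i : nat) : set (A * B)%type := [set x | filt i x.1 /\ filt i x.2].

Fact dfilt_all : dfilt 0 = setT.
Proof.
by apply/seteqP; split=> // x _; rewrite /dfilt /= (filt_all A) (filt_all B).
Qed.

Fact dfilt_decr i : dfilt i.+1 `<=` dfilt i.
Proof. by move=> x [h1 h2]; split; apply: filt_decr. Qed.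

Fact dfilt_zero i : dfilt i 0.
Proof. by split; apply: filt_zero. Qed.

Fact dfilt_lin i (a : R) x y : dfilt i x -> dfilt i y -> dfilt i (a *: x + y).
Proof. by move=> [h1 h2] [h3 h4]; split; apply: filt_lin. Qed.

Fact dfilt_mul i j x y : dfilt i x -> dfilt j y -> dfilt (i + j) (x * y).
Proof. by move=> [h1 h2] [h3 h4]; split; apply: filt_mul. Qed.

Fact dfilt_separated x : (forall i, dfilt i x) -> x = 0.
Proof.
case: x => x y h; congr pair; apply: filt_separated => i; by case: (h i).
Qed.

Fact dfilt_complete (u : nat -> (A * B)%type) :
  (forall i, exists N, forall m m',
     (N <= m)%N -> (N <= m')%N -> dfilt i (u m - u m')) ->
  exists l, forall i, exists N, forall m, (N <= m)%N -> dfilt i (u m - l).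
Proof.
move=> h.
have [|x hx] := @filt_complete _ A (fun m => (u m).1).
  by move=> i; have [N hN] := h i; exists N => m m' *; case: (hN m m').
have [|y hy] := @filt_complete _ B (fun m => (u m).2).
  by move=> i; have [N hN] := h i; exists N => m m' *; case: (hN m m').
exists (x, y) => i; have [N hN] := hx i; have [M hM] := hy i.
exists (maxn N M) => m; rewrite geq_max => /andP[le1 le2].
by split; [apply: hN | apply: hM].
Qed.

Fact dfilt_findim i : exists d (e : 'I_d -> (A * B)%type),
  forall x, exists c : 'I_d -> R, dfilt i (x - \sum_(k < d) c k *: e k).
Proof.
have [d [e he]] := filt_findim A i; have [d' [e' he']] := filt_findim B i.
exists (d + d')%N, (fun k => match fintype.split k with
  inl j => (e j, 0) | inr j => (0, e' j) end) => -[x y].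
have [c hc] := he x; have [c' hc'] := he' y.
exists (fun k => match fintype.split k with inl j => c j | inr j => c' j end).
have s1 j : fintype.split (lshift d' j) = inl j by exact: (unsplitK (inl j)).
have s2 j : fintype.split (rshift d j) = inr j by exact: (unsplitK (inr j)).
rewrite big_split_ord /=.
under eq_bigr do rewrite s1.
under [X in _ - (_ + X)]eq_bigr do rewrite s2.
split; rewrite /= !raddf_sum /=.
  by rewrite [X in _ - (_ + X)]big1 ?addr0 // => k _; rewrite scaler0.
by rewrite [X in _ - (X + _)]big1 ?add0r // => k _; rewrite scaler0.
Qed.

Definition dsum : convAlg R :=
  ConvAlg dfilt_all dfilt_decr dfilt_zero dfilt_lin dfilt_mul
    dfilt_separated dfilt_complete dfilt_findim.

End DirectSum.

Section Limits.
Variables (R : realType) (A : convAlg R).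
Implicit Types (u : nat -> A) (x y l : A).

Definition fcvg u l : Prop :=
  forall i, exists N, forall m, (N <= m)%N -> filt i (u m - l).

(* Limits are unique because the filtration is separated; 0 if there is none. *)
Definition flim u : A := xget 0 [set l | fcvg u l].

(* The two-sided inverse of a unit, and 0 off the units. *)
Definition ainv x : A := xget 0 [set y | x * y = 1 /\ y * x = 1].

Definition aexp x : A := flim (fun N => \sum_(k < N) (k`!%:R)^-1 *: x ^+ k).

(* Linear functionals that are continuous for the filtration topology. *)
Definition fcontinuous (f : {scalar A}) : Prop :=
  exists i, forall x, filt i x -> f x = 0.

(* The integral in an inverse limit of finite-dimensional spaces is computed in
   each quotient A / filt i, coordinate by coordinate; that is, against all the
   linear functionals that vanish on some filt i. *)
Definition is_aint (a b : R) (f : R -> A) (I : A) : Prop :=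
  forall phi : {scalar A}, fcontinuous phi ->
    (@lebesgue_measure R).-integrable `[a, b] (EFin \o (fun t => phi (f t))) /\
    phi I = \int[@lebesgue_measure R]_(t in `[a, b]) phi (f t).

Definition aint (a b : R) (f : R -> A) : A := xget 0 [set I | is_aint a b f I].

Definition pol (h : A) : A :=
  aint 0 (2 * pi) (fun t =>
    (2 * pi)^-1 *:
      (h * ainv ((cos t ^+ 2)%:A - (sin t ^+ 2) *: h ^+ 2))).

(* part false q x and part true q x are the components x^0_q and x^1_q. *)
Definition part (b : bool) (q x : A) : A :=
  2^-1 *: (if b then x - ainv q * x * q else x + ainv q * x * q).

End Limits.

(* Elements of {0,1}^n. *)
Notation mindex n := {ffun 'I_n -> bool}.

Section Tuples.
Variables (R : realType) (n : nat) (A : convAlg R).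
Implicit Types (a b q r : {ffun 'I_n -> A}) (i : mindex n).

Definition clifford q : Prop :=
  forall j k, q j * q k + q k * q j = - (2 *+ (j == k)).

Definition tfilt (m : nat) a : Prop := forall k, filt m (a k).

Definition near_clifford a : Prop := exists2 q, clifford q & tfilt 1 (a - q).

Definition tcvg (u : nat -> {ffun 'I_n -> A}) b : Prop :=
  forall k, fcvg (fun m => u m k) (b k).

Definition mpow q i : A := \prod_(k < n) q k ^+ i k.

Definition tsign i a : {ffun 'I_n -> A} := [ffun k => (-1) ^+ i k *: a k].

Definition tAd (x : A) a : {ffun 'I_n -> A} := [ffun k => x * a k * ainv x].

Definition tdiv r q i (j : 'I_n) : A :=
  foldl (fun x k => part (i k) (q k) x) (r j * ainv (q j)) (enum 'I_n).

(* Gram-Schmidt: qs is the list of the vectors already constructed. *)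
Definition GS_step (qs : seq A) (x : A) : seq A :=
  rcons qs (pol (foldl (fun y z => part true z y) x qs)).

Definition GS a : {ffun 'I_n -> A} :=
  [ffun k : 'I_n => nth 0 (foldl GS_step [::] [seq a j | j <- enum 'I_n]) k].

End Tuples.

Section Operations.
Variables (R : realType) (n : nat).

(* Partial operations on n-tuples: None means outside of the domain. *)
Definition FQop : Type :=
  forall A : convAlg R, {ffun 'I_n -> A} -> option {ffun 'I_n -> A}.

Implicit Type Psi : FQop.

Definition FQ_domain Psi : Prop :=
  forall (A : convAlg R) (a : {ffun 'I_n -> A}),
    Psi A a <-> near_clifford a.

Definition FQ_natural Psi : Prop :=
  (forall (A B : convAlg R) (f : {lrmorphism A -> B}),
     (forall i x, filt i x -> filt i (f x)) ->
     forall a b, Psi A a = Some b ->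
       Psi B [ffun k => f (a k)] = Some [ffun k => f (b k)]) /\
  (forall (A B : convAlg R) (a : {ffun 'I_n -> A}) (b : {ffun 'I_n -> B}),
     Psi A a -> Psi B b -> Psi (dsum A B) [ffun k => (a k, b k)]).

(* psi k i0 [:: (j_1, i_1); ...; (j_r, i_r)] is the coefficient of
   Q^i0 R_{j_1} Q^i_1 ... R_{j_r} Q^i_r in the k-th component. *)
Definition FQ_analytic Psi : Prop :=
  exists psi : 'I_n -> mindex n -> seq ('I_n * mindex n) -> R,
  forall (A : convAlg R) (q r : {ffun 'I_n -> A}), clifford q -> tfilt 1 r ->
  exists2 b, Psi A (q + r) = Some b &
  forall k, fcvg (fun N => \sum_(d < N)
    \sum_(i0 : mindex n) \sum_(s : d.-tuple ('I_n * mindex n))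
      psi k i0 s *:
        (mpow q i0 * \prod_(x <- s) (r x.1 * mpow q x.2))) (b k).

Definition FQ_operation Psi : Prop :=
  [/\ FQ_domain Psi, FQ_natural Psi & FQ_analytic Psi].

Definition FQ_orthogonalization Psi : Prop :=
  FQ_operation Psi /\
  forall (A : convAlg R) (a b : {ffun 'I_n -> A}),
    Psi A a = Some b -> clifford b.

Definition FQ_vC Psi : Prop :=
  forall (A : convAlg R) (q : {ffun 'I_n -> A}),
    clifford q -> Psi A q = Some q.

Definition FQ_vL Psi : Prop :=
  forall (A : convAlg R) (i : mindex n) (a b : {ffun 'I_n -> A}),
    Psi A a = Some b -> Psi A (tsign i a) = Some (tsign i b).

(* j = min {h | i h = 1}; never holds for i = 0. *)
Definition is_first (j : 'I_n) (i : mindex n) : bool :=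
  i j && [forall h : 'I_n, i h ==> (j <= h)%N].

(* An index sequence lists the pairs (j_s, iota_s). *)
Definition GS_index (s : seq ('I_n * mindex n)) : bool :=
  [&& (0 < size s)%N,
      all (fun x => ~~ is_first x.1 x.2) s
    & [exists h : 'I_n, \big[addb/false]_(x <- s) x.2 h]].

Definition GS_data : Type := {s : seq ('I_n * mindex n) | GS_index s} -> R.

(* p extended by 0 to all index sequences. *)
Definition GS_coef (p : GS_data) (s : seq ('I_n * mindex n)) : R :=
  oapp p 0 (insub s).

Section Procedure.
Variables (p : GS_data) (A : convAlg R).
Implicit Types a q : {ffun 'I_n -> A}.

(* E^<d>, for R = r and Q = q. *)
Definition GS_exponent (r q : {ffun 'I_n -> A}) (d : nat) : A :=
  \sum_(s : d.-tuple ('I_n * mindex n) | GS_index s)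
    GS_coef p s *: \prod_(x <- s) tdiv r q x.2 x.1.

(* Ad (exp E^<1>) (Ad (exp E^<2>) (... (Ad (exp E^<N>) Q))), Q = GS a. *)
Definition GS_partial a (N : nat) : {ffun 'I_n -> A} :=
  let q := GS a in
  foldr (fun d b => tAd (aexp (GS_exponent (a - q) q d)) b) q (iota 1 N).

End Procedure.

(* Some b when a is near a Clifford system and the infinite product converges
   to b, and None otherwise. *)
Definition GS_procedure (p : GS_data) : FQop := fun A a =>
  xget None [set o | exists2 b, o = Some b &
    near_clifford a /\ tcvg (GS_partial p a) b].

End Operations.

(* Main.v *)
Require Import Defs.
From HB Require Import structures.
From mathcomp Require Import all_boot all_order all_algebra.
From mathcomp Require Import all_classical all_reals all_analysis.
From mathcomp Require Import ring lra.
Set Implicit Arguments.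
Unset Strict Implicit.
Unset Printing Implicit Defensive.
Import Order.TTheory GRing.Theory Num.Theory.
Local Open Scope ring_scope.

(** Why the theorem holds.

The Gram-Schmidt system [Q] of a tuple [A] is the only Clifford system that is congruent
to [A] modulo the first step of the filtration and for which the [k]-th residue of [A],
obtained by removing the parts that commute with one of the previous vectors, commutes
with [Q_k] ([GS_spec], [GS_spec_unique], [GS_specP]). This rests on the polar part being
[h * (- h^2)^(-1/2)], a power series whose coefficients are the means of the even powers
of the sine. For the remainder [R = A - Q] the conditions imply that the components
[(R/Q)^i_j] vanish when [j] is the first index of [i] ([tdiv_first]); the other components
are arbitrary. Naturality of the system and its behaviour under sign changes follow from
its uniqueness.

The algebra [univ] consists of the formal power series in letters [x_(j,i)] with
coefficients in the Clifford algebra, for the rule that [Q_k] commutes with [x_(j,i)] up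
to the sign [(-1)^(i_k)]. For every Clifford system [Q] and every [R] in the first step of
the filtration there is a morphism to the given algebra that maps the letters to the
components of [R/Q] ([univ_eval]). Hence a natural operation is known from a single value:
with the tuple that contains all the letters this gives analyticity
([natural_analytic]), and with the tuple [univA] that contains only the letters
[x_(j,i)] where [j] is not the first index of [i], whose Gram-Schmidt system is [Q] itself,
it gives that operations that agree on [univA] are equal ([FQ_ext]).

It remains to see that the Clifford systems [b] that can be values at [univA] correspond to
the data. By (vL), (vC) and naturality, [b_k = d_k Q_k] for a series [d_k] in the letters
of [univA] alone, with constant term 1 ([Psi_univ]). Suppose that [b] agrees with [Q] below
degree [d]. The Clifford relations in degree [d] say that the coefficient of a word
[x_w] in [d_k] is zero if [x_w] commutes with [Q_k], and that it does not depend on [k]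
otherwise ([leading_comm]). The commutators [E Q_k - Q_k E] have the same form, with [E] a
combination of words of degree [d] that do not commute with all the [Q_k]; these are the
words that are allowed as indices, and [E] is determined by its commutators. Conjugating
by [exp(-E)] makes [b] agree with [Q] in degree [d] also, and so on: this gives existence
([GS_procedure_surj]) and uniqueness ([GS_procedure_inj]) of the data.

For the number of coefficients, the words of length [r] in the letters of [univA] are
counted by weight. There are [n - 1] such letters for each [i], and one more for [i = 0],
so that the number of words of weight 0 satisfies a linear recurrence. *)

(** * Summation in a convenient algebra *)

Section Filtration.
Variables (R : realType) (A : convAlg R).
Implicit Types (x y s e : A) (u v : nat -> A) (i j N : nat).

Lemma filtZ i (c : R) x : filt i x -> filt i (c *: x).
Proof. by move=> hx; rewrite -[_ *: _]addr0; apply: filt_lin => //; apply: filt_zero. Qed.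

Lemma filtD i x y : filt i x -> filt i y -> filt i (x + y).
Proof. by move=> hx hy; rewrite -[x]scale1r; apply: filt_lin. Qed.

Lemma filtN i x : filt i x -> filt i (- x).
Proof. by rewrite -scaleN1r; apply: filtZ. Qed.

Lemma filtB i x y : filt i x -> filt i y -> filt i (x - y).
Proof. by move=> hx hy; apply: filtD => //; apply: filtN. Qed.

Lemma filtBC i x y : filt i (x - y) -> filt i (y - x).
Proof. by move=> h; rewrite -opprB; apply: filtN. Qed.

Lemma filt0T x : filt 0 x.
Proof. by rewrite filt_all. Qed.

Lemma filtMl i x y : filt i y -> filt i (x * y).
Proof. by move=> hy; rewrite -[i]add0n; apply: filt_mul (filt0T x) hy. Qed.

Lemma filtMr i x y : filt i x -> filt i (x * y).
Proof. by move=> hx; rewrite -[i]addn0; apply: filt_mul hx (filt0T y). Qed.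

Lemma filt_le i j x : (i <= j)%N -> filt j x -> filt i x.
Proof.
by move/subnK<-; elim: (j - i)%N => // k IH; rewrite addSn => /filt_decr.
Qed.

Lemma filt_sum i (I : Type) (r : seq I) (P : pred I) (F : I -> A) :
  (forall k, P k -> filt i (F k)) -> filt i (\sum_(k <- r | P k) F k).
Proof. by move=> h; elim/big_ind: _ => //; [apply: filt_zero | apply: filtD]. Qed.

Lemma filtX i s k : filt i s -> filt (k * i) (s ^+ k).
Proof.
by move=> hs; elim: k => [|k IH]; [apply: filt0T | rewrite exprS mulSn; apply: filt_mul].
Qed.

Lemma filt_trans i y x z : filt i (x - y) -> filt i (y - z) -> filt i (x - z).
Proof. by move=> h1 h2; rewrite -(subrKA y); apply: filtD. Qed.

Lemma filt_mulB i x x' y y' :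
  filt i (x - x') -> filt i (y - y') -> filt i (x * y - x' * y').
Proof.
move=> h1 h2; apply: (@filt_trans _ (x' * y)).
  by rewrite -mulrBl; apply: filtMr.
by rewrite -mulrBr; apply: filtMl.
Qed.

Lemma filt_eq x y : (forall i, filt i (x - y)) -> x = y.
Proof. by move=> h; apply/eqP; rewrite -subr_eq0; apply/eqP/filt_separated. Qed.

Lemma fcvg_uniq u x y : fcvg u x -> fcvg u y -> x = y.
Proof.
move=> hx hy; apply: filt_eq => i.
have [N hN] := hx i; have [M hM] := hy i.
apply: (@filt_trans _ (u (maxn N M))); last exact: hM (leq_maxr _ _).
exact: filtBC (hN _ (leq_maxl _ _)).
Qed.

Lemma flim_eq u x : fcvg u x -> flim u = x.
Proof. by move=> hu; apply: xget_unique => // y hy; apply: fcvg_uniq hy hu. Qed.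

Definition fsum u : A := flim (fun N => \sum_(d < N) u d).

Definition null_seq u := forall d, filt d (u d).

Lemma sum_tail u i N : null_seq u -> (i <= N)%N ->
  filt i (\sum_(d < N) u d - \sum_(d < i) u d).
Proof.
move=> hu /subnK <-; elim: (N - i)%N => [|k IH]; first by rewrite subrr; apply: filt_zero.
rewrite addSn big_ord_recr /= addrAC; apply: filtD => //.
by apply: filt_le (hu _); rewrite leq_addl.
Qed.

Lemma fsum_cvg u : null_seq u -> fcvg (fun N => \sum_(d < N) u d) (fsum u).
Proof.
move=> hu; have [|l hl] := @filt_complete _ A (fun N => \sum_(d < N) u d).
  move=> i; exists i => m m' hm hm'.
  by apply: filt_trans (sum_tail hu hm) (filtBC (sum_tail hu hm')).
by rewrite /fsum (flim_eq (hl : fcvg _ _)).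
Qed.

Lemma fsum_tail u i : null_seq u -> filt i (fsum u - \sum_(d < i) u d).
Proof.
move=> hu; have [N hN] := fsum_cvg hu i.
apply: filt_trans (sum_tail hu (leq_maxl i N)).
exact: filtBC (hN _ (leq_maxr _ _)).
Qed.

Lemma fsum_eq u x :
  (forall i, filt i (x - \sum_(d < i) u d)) -> fsum u = x.
Proof.
move=> h; apply: flim_eq => i; exists i => N hN.
by apply: filtBC; apply: filt_le hN _.
Qed.

Lemma fsum_lin (a : R) u v : null_seq u -> null_seq v ->
  a *: fsum u + fsum v = fsum (fun d => a *: u d + v d).
Proof.
move=> hu hv; apply/esym/fsum_eq => i.
rewrite big_split /= -scaler_sumr opprD addrACA -scalerBr.
by apply: filt_lin; apply: fsum_tail.
Qed.

Lemma fsumMl x u : null_seq u -> x * fsum u = fsum (fun d => x * u d).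
Proof.
move=> hu; apply/esym/fsum_eq => i.
by rewrite -mulr_sumr -mulrBr; apply/filtMl/fsum_tail.
Qed.

Lemma fsumMr x u : null_seq u -> fsum u * x = fsum (fun d => u d * x).
Proof.
move=> hu; apply/esym/fsum_eq => i.
by rewrite -mulr_suml -mulrBl; apply/filtMr/fsum_tail.
Qed.

Lemma fsum1 u : (forall d, (0 < d)%N -> u d = 0) -> fsum u = u 0%N.
Proof.
move=> h; apply: fsum_eq => -[|i]; first exact: filt0T.
rewrite big_ord_recl big1 ?addr0 ?subrr; first exact: filt_zero.
by move=> k _; apply: h.
Qed.

Lemma fsum_filt u k : null_seq u -> (forall d, filt k (u d)) -> filt k (fsum u).
Proof.
move=> hu h; rewrite -[fsum u](subrK (\sum_(d < k) u d)).
by apply: filtD; [apply: fsum_tail | apply: filt_sum].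
Qed.

Definition conv u v d := \sum_(c < d.+1) u c * v (d - c)%N.

(** The product of the sums is compared with the triangular sums
    [\sum_(i < N) u i * S_(N - i) v], where [S] are the partial sums of [v]:
    the terms that are left out lie in [filt N]. *)
Lemma fsumM u v : null_seq u -> null_seq v ->
  fsum u * fsum v = fsum (conv u v).
Proof.
move=> hu hv; apply/esym/fsum_eq => N.
have -> : \sum_(d < N) conv u v d =
    \sum_(i < N) u i * \sum_(j < N - i) v j.
  elim: N => [|N IH]; first by rewrite !big_ord0.
  rewrite big_ord_recr /= {}IH [in RHS]big_ord_recr /= subSnn big_ord1.
  rewrite /conv big_ord_recr /= subnn addrA -big_split /=; congr (_ + _).
  apply: eq_bigr => i _; rewrite subSn; last exact: ltnW.
  by rewrite big_ord_recr /= mulrDr.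
apply: (@filt_trans _ (\sum_(i < N) u i * fsum v)).
  by rewrite -mulr_suml -mulrBl; apply/filtMr/fsum_tail.
rewrite -sumrB; apply: filt_sum => i _; rewrite -mulrBr.
rewrite -[N in filt N](subnKC (ltnW (ltn_ord i))).
by apply: filt_mul => //; apply: fsum_tail.
Qed.

(** Substitution of [s] in the formal power series with coefficients [c]. *)
Definition ps (c : nat -> R) s : A := fsum (fun k => c k *: s ^+ k).

Lemma null_ps c s : filt 1 s -> null_seq (fun k => c k *: s ^+ k).
Proof. by move=> hs d; apply: filtZ; rewrite -{1}[d]muln1; apply: filtX. Qed.

Lemma ps_mul (c d : nat -> R) s : filt 1 s ->
  ps c s * ps d s = ps (fun k => \sum_(i < k.+1) c i * d (k - i)%N) s.
Proof.
move=> hs; rewrite /ps fsumM; [|exact: null_ps..].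
congr fsum; apply/funext => k; rewrite /conv scaler_suml.
apply: eq_bigr => i _.
by rewrite -scalerAl -scalerAr scalerA -exprD subnKC // -ltnS.
Qed.

Lemma ps_comm (c : nat -> R) s x : filt 1 s -> x * s = s * x ->
  x * ps c s = ps c s * x.
Proof.
move=> hs hx; rewrite /ps fsumMl ?fsumMr; [|exact: null_ps..].
congr fsum; apply/funext => k; rewrite -scalerAr -scalerAl; congr (_ *: _).
exact: (@commrX _ x s k hx).
Qed.

Lemma ps_const (c : nat -> R) s : (forall k, (0 < k)%N -> c k = 0) ->
  ps c s = (c 0%N)%:A.
Proof. by move=> h; rewrite /ps fsum1 ?expr0 // => d hd; rewrite h ?scale0r. Qed.

Lemma ps_near (c : nat -> R) s : filt 1 s -> filt 1 (ps c s - (c 0%N)%:A).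
Proof.
move=> hs; have := fsum_tail 1 (null_ps c hs).
by rewrite big_ord1 expr0.
Qed.

Lemma ps_near2 (c : nat -> R) s d : (0 < d)%N -> filt d s ->
  filt (d + d) (ps c s - ((c 0%N)%:A + c 1%N *: s)).
Proof.
move=> d0 hs; have hs1 : filt 1 s by apply: filt_le hs.
have [N E] : exists N, (d + d = N.+2)%N by exists (d + d).-2; case: (d) d0 => // k _; rewrite addnS.
have := fsum_tail N.+2 (null_ps c hs1); rewrite -{1}E => h.
apply: filt_trans h _.
rewrite !big_ord_recl /= expr0 expr1 addrA [_ + _ - _]addrAC subrr add0r.
apply: filt_sum => k _; apply: filtZ; rewrite addnn -mul2n.
by apply: filt_le (filtX _ hs); rewrite leq_mul2r orbT.
Qed.

Lemma aexpE s : aexp s = ps (fun k => (k`!%:R)^-1) s.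
Proof. by []. Qed.

(** Both factors are power series in [s]; the coefficients of the product are
    [(1 - 1) ^ k / k!]. *)
Lemma aexp_mulN s : filt 1 s -> aexp s * aexp (- s) = 1.
Proof.
move=> hs; have -> : aexp (- s) = ps (fun k => (-1) ^+ k / k`!%:R) s.
  congr flim; apply/funext => N; apply: eq_bigr => k _.
  by rewrite -scaleN1r exprZn scalerA mulrC.
rewrite aexpE ps_mul // ps_const => [|k k0].
  by rewrite big_ord1 fact0 invr1 !mul1r scale1r.
transitivity ((k`!%:R)^-1 * (1 - 1) ^+ k : R); last by rewrite subrr expr0n gtn_eqF ?mulr0.
rewrite exprBn mulr_sumr (reindex_inj rev_ord_inj) /=; apply: eq_bigr => i _.
rewrite subSS expr1n mulr1 expr1n mulr1 subKn; last by rewrite -ltnS.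
have hi : (i <= k)%N by rewrite -ltnS.
have /(congr1 (fun m => m%:R : R)) := bin_fact hi; rewrite !natrM => <-.
rewrite -mulr_natr; field.
by rewrite !pnatr_eq0 -!lt0n !fact_gt0 bin_gt0 hi.
Qed.

End Filtration.

Section FilteredMorphism.
Variables (R : realType) (A B : convAlg R) (f : {lrmorphism A -> B}).
Hypothesis hf : forall i x, filt i x -> filt i (f x).

Lemma filtered_fsum (u : nat -> A) : null_seq u -> f (fsum u) = fsum (f \o u).
Proof.
move=> hu; apply/esym/fsum_eq => i /=.
by rewrite -raddf_sum -raddfB; apply/hf/fsum_tail.
Qed.

Lemma filtered_ps (c : nat -> R) (s : A) : filt 1 s -> f (ps c s) = ps c (f s).
Proof.
move=> hs; rewrite /ps filtered_fsum; last exact: null_ps.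
by congr fsum; apply/funext => k /=; rewrite linearZ /= rmorphXn.
Qed.

Lemma filtered_aexp (e : A) : filt 1 e -> f (aexp e) = aexp (f e).
Proof. by move=> he; rewrite !aexpE filtered_ps. Qed.

Lemma filtered_fcvg (u : nat -> A) x : fcvg u x -> fcvg (f \o u) (f x).
Proof.
move=> hu i; have [N hN] := hu i; exists N => m hm /=.
by rewrite -raddfB; apply/hf/hN.
Qed.

End FilteredMorphism.

Section Inverse.
Variables (R : realType) (A : convAlg R).
Implicit Types (x y e : A).

Lemma ainv_eq x y : x * y = 1 -> y * x = 1 -> ainv x = y.
Proof.
move=> h1 h2; apply: xget_unique => // z [h3 h4].
by rewrite -[z]mulr1 -h1 mulrA h4 mul1r.
Qed.

Lemma aexp_Nmul e : filt 1 e -> aexp (- e) * aexp e = 1.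
Proof. by move=> he; rewrite -{2}[e]opprK aexp_mulN //; apply: filtN. Qed.

Lemma ainv_aexp e : filt 1 e -> ainv (aexp e) = aexp (- e).
Proof. by move=> he; apply: ainv_eq; [apply: aexp_mulN | apply: aexp_Nmul]. Qed.

Lemma aexp0 : aexp (0 : A) = 1.
Proof.
rewrite aexpE /ps fsum1 => [|[|d] // _]; last by rewrite exprS mul0r scaler0.
by rewrite expr0 fact0 invr1 scale1r.
Qed.

Lemma aexp_near e d : (0 < d)%N -> filt d e -> filt (d + d) (aexp e - (1 + e)).
Proof.
by move=> d0 /(ps_near2 (fun k => (k`!%:R)^-1 : R) d0); rewrite !invr1 !scale1r.
Qed.

Lemma ainvN1 x : x * x = -1 -> ainv x = - x.
Proof. by move=> h; apply: ainv_eq; rewrite ?mulrN ?mulNr h opprK. Qed.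

End Inverse.

(** * Means of even powers of the sine *)

Section Wallis.
Import numFieldNormedType.Exports.
Local Open Scope classical_set_scope.
Variable R : realType.
Local Notation mu := (@lebesgue_measure R).
Implicit Types (k N : nat) (a : nat -> R).

Definition sin_mean k : R :=
  \int[mu]_(t in `[0, 2 * pi]) ((2 * pi)^-1 * sin t ^+ k.*2).

Lemma continuous_sinX k : continuous (fun t : R => sin t ^+ k).
Proof.
elim: k => [|k IH] t; first by under eq_fun do rewrite expr0; apply: cvg_cst.
by under eq_fun do rewrite exprS; apply: cvgM; [apply: continuous_sin | apply: IH].
Qed.

Lemma integrable_sinX (b : R) k :
  mu.-integrable `[0, 2 * pi] (EFin \o (fun t : R => b * sin t ^+ k)).
Proof.
apply: continuous_compact_integrable; first exact: segment_compact.
by apply: continuous_subspaceT => t; apply: cvgM; [apply: cvg_cst | apply: continuous_sinX].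
Qed.

Lemma integrable_sin k :
  mu.-integrable `[0, 2 * pi] (EFin \o (fun t : R => sin t ^+ k)).
Proof.
rewrite [X in EFin \o X](_ : _ = fun t => 1 * sin t ^+ k); first exact: integrable_sinX.
by apply/funext => t; rewrite mul1r.
Qed.

Lemma integrable_sin_poly a N :
  mu.-integrable `[0, 2 * pi]
    (EFin \o (fun t : R => \sum_(k < N) a k * ((2 * pi)^-1 * sin t ^+ k.*2))).
Proof.
apply: continuous_compact_integrable; first exact: segment_compact.
apply: continuous_subspaceT; elim: N => [|N IH] t.
  by under eq_fun do rewrite big_ord0; apply: cvg_cst.
under eq_fun do rewrite big_ord_recr /=; apply: cvgD; first exact: IH.
by apply: cvgM; [apply: cvg_cst | apply: cvgM; [apply: cvg_cst | apply: continuous_sinX]].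
Qed.

Lemma integral_sin_poly a N :
  \int[mu]_(t in `[0, 2 * pi])
    (\sum_(k < N) a k * ((2 * pi)^-1 * sin t ^+ k.*2)) =
  \sum_(k < N) a k * sin_mean k.
Proof.
elim: N => [|N IH].
  rewrite big_ord0; under eq_Rintegral do rewrite big_ord0.
  by rewrite Rintegral_cst // mul0r.
under eq_Rintegral do rewrite big_ord_recr /=.
rewrite RintegralD //; first last.
- rewrite [X in EFin \o X](_ : _ = fun t => a N * (2 * pi)^-1 * sin t ^+ N.*2).
    exact: integrable_sinX.
  by apply/funext => t; rewrite mulrA.
- exact: integrable_sin_poly.
by rewrite IH big_ord_recr /= RintegralZl //; apply: integrable_sinX.
Qed.

Lemma sin_mean0 : sin_mean 0 = 1.
Proof.
rewrite /sin_mean; under eq_Rintegral do rewrite expr0 mulr1.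
have p0 : 0 < 2 * pi :> R by rewrite mulr_gt0 ?pi_gt0.
rewrite Rintegral_cst //= lebesgue_measure_itv /= lte_fin p0 /= subr0.
by rewrite mulVf // gt_eqF.
Qed.

(** The derivative of [sin ^ (2 k + 1) * cos] has integral 0 over a period. *)
Lemma sin_mean_rec k :
  k.+1.*2%:R * sin_mean k.+1 = k.*2.+1%:R * sin_mean k.
Proof.
have p0 : 0 < 2 * pi :> R by rewrite mulr_gt0 ?pi_gt0.
pose F t : R := sin t ^+ k.*2.+1 * cos t.
pose f t : R := k.*2.+1%:R * sin t ^+ k.*2 - k.+1.*2%:R * sin t ^+ k.+1.*2.
have dF (t : R) : is_derive t 1 F (f t).
  have -> : F = (@sin R : R -> R) ^+ k.*2.+1 * (@cos R : R -> R) by apply/funext => x; rewrite /F !fctE.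
  apply: is_derive_eq.
  rewrite /f /GRing.scale /= !fctE doubleS.
  rewrite [X in _ + X](_ : _ = k.*2.+1%:R * sin t ^+ k.*2 * cos t ^+ 2); last by ring.
  by rewrite cos2sin2 -[k.*2.+2%:R]natr1 !exprS; ring.
have cf : continuous f.
  move=> t; apply: cvgB; (apply: cvgM; [apply: cvg_cst | apply: continuous_sinX]).
have cF : continuous F.
  by move=> t; apply: cvgM; [apply: continuous_sinX | apply: continuous_cos].
have s0 : sin (2 * pi) = 0 :> R by rewrite mulrC mulr_natr sin_mulr2n sinpi mulr0 mul0rn.
have := @continuous_FTC2 R f F 0 (2 * pi) p0 (continuous_subspaceT cf).
have -> : F (2 * pi) = 0 by rewrite /F s0 exprS !mul0r.
have -> : F 0 = 0 by rewrite /F sin0 exprS !mul0r.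
have mE m : sin_mean m = (2 * pi)^-1 * \int[mu]_(t in `[0, 2 * pi]) (sin t ^+ m.*2).
  by rewrite /sin_mean RintegralZl //; apply: integrable_sin.
move=> /(_ _ _)/(congr1 fine) /=; rewrite subr0 => h.
have : \int[mu]_(t in `[0, 2 * pi]) f t = 0.
  apply: h; first split.
  - by move=> x _; apply: ex_derive.
  - exact: (@cvg_at_right_filter R R F 0 (F 0) (cF 0)).
  - exact: (@cvg_at_left_filter R R F (2 * pi) (F (2 * pi)) (cF (2 * pi))).
  by move=> x _; rewrite derive1E derive_val.
rewrite RintegralB // ?RintegralZl // ?mE; try exact: integrable_sin; try exact: integrable_sinX.
move/eqP; rewrite subr_eq0 => /eqP E.
by rewrite mulrCA -E mulrCA.
Qed.

End Wallis.

(** * The polar part *)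

(** The generating function of the means is [(1 - X)^(-1/2)]. Its square is
    [1 / (1 - X)] because the recurrence [sin_mean_rec], multiplied by [sin_mean]
    and symmetrized, makes the convolutions [d k] independent of [k]. *)
Lemma sin_mean_conv (R : realType) k :
  \sum_(i < k.+1) sin_mean R i * sin_mean R (k - i) = 1.
Proof.
pose w := sin_mean R; pose d k := \sum_(i < k.+1) w i * w (k - i)%N.
pose S k := \sum_(i < k.+1) i%:R * (w i * w (k - i)%N).
have SE m : 2 * S m = m%:R * d m.
  rewrite mulr_natl mulr2n {2}/S (reindex_inj rev_ord_inj) -big_split /= mulr_sumr.
  apply: eq_bigr => i _; rewrite subSS subKn; last by rewrite -ltnS.
  rewrite natrB; last by rewrite -ltnS.
  by ring.
suff dS m : d m.+1 = d m.
  rewrite -/(d k); elim: k => [|k IH]; last by rewrite dS.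
  by rewrite /d big_ord1 /w sin_mean0 mulr1.
have m0 : m.+1%:R != 0 :> R by rewrite pnatr_eq0.
apply: (mulfI m0); rewrite -SE /S big_ord_recl mul0r add0r.
transitivity (2 * S m + d m); last by rewrite SE -natr1; ring.
rewrite /S /d !mulr_sumr -big_split /=; apply: eq_bigr => i _.
have := sin_mean_rec R i; rewrite -/w.
have -> : i.+1.*2%:R = 2 * i.+1%:R :> R by rewrite -mul2n natrM.
have -> : i.*2.+1%:R = 2 * i%:R + 1 :> R by rewrite -natr1 -mul2n natrM.
move=> E; rewrite /bump /= add1n subSS !mulrA E; ring.
Qed.

Section Functionals.
Local Open Scope classical_set_scope.
Variables (R : realType) (A : convAlg R).
Implicit Types (x y : A).

(** A family that spans modulo [filt i] and has minimal size is independent: in a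
    relation with a nonzero coefficient, that vector could be dropped. *)
Lemma filt_basis i : exists d (e : 'I_d -> A),
  (forall x, exists c : 'I_d -> R, filt i (x - \sum_(k < d) c k *: e k)) /\
  (forall c : 'I_d -> R, filt i (\sum_(k < d) c k *: e k) -> forall k, c k = 0).
Proof.
pose P d := `[< exists e : 'I_d -> A, forall x,
  exists c : 'I_d -> R, filt i (x - \sum_(k < d) c k *: e k) >].
have exP : exists d, P d.
  by have [d [e he]] := filt_findim A i; exists d; apply/asboolP; exists e.
have [d /asboolP[e he] min_d] := ex_minnP exP; exists d, e; split=> // c hc k.
apply/eqP/negP => /negP ck0.
case: d e he min_d c hc k ck0 => [|d] e he min_d c hc k ck0; first by case: k {ck0}.
suff : P d by move/min_d; rewrite ltnn.
apply/asboolP; exists (fun j => e (lift k j)) => x; have [b hb] := he x.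
exists (fun j => b (lift k j) - b k / c k * c (lift k j)).
rewrite -[X in filt i X](subrK (b k / c k *: \sum_(j < d.+1) c j *: e j)).
apply: filtD; last exact: filtZ.
move: hb; rewrite !(bigD1_ord k) //=.
rewrite scalerDr scalerA -mulrA mulVf // mulr1 scaler_sumr.
under [X in _ - X + _]eq_bigr do rewrite scalerBl.
rewrite sumrB.
under [X in _ -> filt i (_ - (_ + X))]eq_bigr do rewrite scalerA.
by rewrite -[x - _ - _]addrA -opprD [X in _ -> filt i (x - X)]addrC addrACA subrr addr0.
Qed.

(** The coordinates in a basis modulo [filt i] are functionals that kill [filt i]. *)
Lemma separating_functional i x : ~ filt i x ->
  exists2 phi : {scalar A}, (forall y, filt i y -> phi y = 0) & phi x <> 0.
Proof.
move=> hx; have [d [e [he ind]]] := filt_basis i.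
have [c hc] := choice he.
have uniq (y : A) (b : 'I_d -> R) : filt i (y - \sum_(k < d) b k *: e k) -> c y =1 b.
  move=> hb k; apply/eqP; rewrite -subr_eq0; apply/eqP.
  apply: (ind (fun k => c y k - b k)).
  under eq_bigr do rewrite scalerBl.
  by rewrite sumrB; apply: filt_trans hb; apply: filtBC.
have [k ck] : exists k, c x k <> 0.
  apply: contrapT => /forallNP h; apply: hx.
  have := hc x; rewrite big1 ?subr0 // => k _.
  by rewrite (contrapT (h k)) scale0r.
have lin : linear_for *%R (fun y => c y k).
  move=> a y z; apply: (uniq _ (fun k => a * c y k + c z k)).
  under eq_bigr do rewrite scalerDl -scalerA.
  by rewrite big_split /= -scaler_sumr opprD addrACA -scalerBr; apply: filt_lin.
pose L := GRing.isLinear.Build R A R *%R (fun y => c y k) lin.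
pose phi : {scalar A} := HB.pack (fun y => c y k) L.
exists phi => // y hy; apply: (uniq y (fun=> 0)).
by rewrite big1 ?subr0 // => j _; rewrite scale0r.
Qed.

(** Continuous functionals separate points, so that the weak integral that defines
    [aint] has at most one value. *)
Lemma is_aint_uniq a b (f : R -> A) x y :
  is_aint a b f x -> is_aint a b f y -> x = y.
Proof.
move=> hx hy; apply: filt_eq => i; apply: contrapT => h.
have [phi phi0 phixy] := separating_functional h.
have cphi : fcontinuous phi by exists i.
have [_ h1] := hx _ cphi; have [_ h2] := hy _ cphi.
by apply: phixy; rewrite raddfB /= h1 h2 subrr.
Qed.

Lemma aint_eq a b (f : R -> A) x : is_aint a b f x -> aint a b f = x.
Proof. by move=> h; apply: xget_unique => // y hy; apply: is_aint_uniq hy h. Qed.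

End Functionals.

Section Pol.
Local Open Scope classical_set_scope.
Variables (R : realType) (A : convAlg R).
Implicit Types (h s q x : A).

Lemma ps_geom (a : R) s : filt 1 s -> (1 - a *: s) * ps (GRing.exp a) s = 1.
Proof.
move=> hs; apply: filt_eq => i.
apply: (@filt_trans _ _ _ ((1 - a *: s) * \sum_(k < i) a ^+ k *: s ^+ k)).
  by rewrite -mulrBr; apply/filtMl/fsum_tail/null_ps.
under eq_bigr do rewrite -exprZn.
rewrite -[1 - _]opprB mulNr -subrX1 opprB addrAC subrr add0r exprZn.
by apply/filtN/filtZ; rewrite -{1}[i]muln1; apply: filtX.
Qed.

(** For [h ^ 2 = s - 1] the denominator [cos ^ 2 t - h ^ 2 * sin ^ 2 t] is
    [1 - sin ^ 2 t * s], whose inverse is a geometric series; it is integrated term by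
    term, and only finitely many terms are seen by a continuous functional. The result
    is [h * (1 - s)^(-1/2)]. *)
Lemma polE h s : filt 1 s -> h ^+ 2 = s - 1 -> pol h = h * ps (sin_mean R) s.
Proof.
move=> hs Eh; apply: aint_eq => phi [i hi].
have E t : phi ((2 * pi)^-1 *: (h * ainv ((cos t ^+ 2)%:A - (sin t ^+ 2) *: h ^+ 2)))
    = \sum_(k < i) phi (h * s ^+ k) * ((2 * pi)^-1 * sin t ^+ k.*2).
  have -> : (cos t ^+ 2)%:A - (sin t ^+ 2) *: h ^+ 2 = 1 - sin t ^+ 2 *: s.
    by rewrite Eh scalerBr opprB addrA -scalerDl cos2Dsin2 scale1r.
  have -> : ainv (1 - sin t ^+ 2 *: s) = ps (fun k => sin t ^+ k.*2) s.
    have -> : (fun k => sin t ^+ k.*2) = GRing.exp (sin t ^+ 2).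
      by apply/funext => k; rewrite -exprM mul2n.
    have E := ps_geom (sin t ^+ 2) hs; apply: ainv_eq => //.
    by rewrite -ps_comm // mulrBl mulrBr -scalerAl -scalerAr mulr1 mul1r.
  have : phi ((2 * pi)^-1 *: (h * ps (fun k => sin t ^+ k.*2) s) - 
     (2 * pi)^-1 *: (h * \sum_(k < i) (sin t ^+ k.*2) *: s ^+ k)) = 0.
    apply: hi; rewrite -scalerBr -mulrBr.
    by apply/filtZ/filtMl/fsum_tail/null_ps.
  rewrite raddfB /= => /eqP; rewrite subr_eq0 => /eqP ->.
  rewrite mulr_sumr scaler_sumr raddf_sum; apply: eq_bigr => k _.
  by rewrite -scalerAr scalerA /= scalarZ mulrC.
under [X in EFin \o X]eq_fun do rewrite E.
under eq_Rintegral do rewrite E.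
split; first exact: (integrable_sin_poly (fun k => phi (h * s ^+ k)) i).
rewrite (integral_sin_poly (fun k => phi (h * s ^+ k)) i).
have : phi (h * ps (sin_mean R) s - h * \sum_(k < i) sin_mean R k *: s ^+ k) = 0.
  by apply: hi; rewrite -mulrBr; apply/filtMl/fsum_tail/null_ps.
rewrite raddfB /= => /eqP; rewrite subr_eq0 => /eqP ->.
rewrite mulr_sumr raddf_sum; apply: eq_bigr => k _.
by rewrite -scalerAr /= scalarZ mulrC.
Qed.

Lemma sin_mean_sqr s : filt 1 s ->
  ps (sin_mean R) s * ps (sin_mean R) s * (1 - s) = 1.
Proof.
move=> hs; rewrite ps_mul // (_ : (fun k => _) = GRing.exp 1).
  have E := ps_geom 1 hs; rewrite scale1r in E.
  by rewrite -ps_comm // mulrBl mulrBr mulr1 mul1r.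
by apply/funext => k; rewrite sin_mean_conv expr1n.
Qed.

Lemma pol_sqr h : filt 1 (h ^+ 2 + 1) -> pol h ^+ 2 = -1.
Proof.
set s := h ^+ 2 + 1 => hs; have Eh : h ^+ 2 = s - 1 by rewrite addrK.
have hc : h * s = s * h by rewrite /s mulrDl mulrDr mulr1 mul1r -exprS -exprSr.
have hP := ps_comm (sin_mean R) hs hc.
rewrite (polE hs Eh) expr2 {1}hP -mulrA [h * (h * _)]mulrA -expr2 Eh.
rewrite ps_comm; [|by []|by rewrite mulrBl mulrBr mul1r mulr1].
by rewrite mulrA -[s - 1]opprB mulrN sin_mean_sqr.
Qed.

Lemma pol_near h : filt 1 (h ^+ 2 + 1) -> filt 1 (pol h - h).
Proof.
set s := h ^+ 2 + 1 => hs; have Eh : h ^+ 2 = s - 1 by rewrite addrK.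
rewrite (polE hs Eh) -[X in _ - X]mulr1 -mulrBr; apply: filtMl.
by have := ps_near (sin_mean R) hs; rewrite sin_mean0 scale1r.
Qed.

Lemma pol_comm h x : filt 1 (h ^+ 2 + 1) -> x * h = h * x -> x * pol h = pol h * x.
Proof.
set s := h ^+ 2 + 1 => hs xh; have Eh : h ^+ 2 = s - 1 by rewrite addrK.
rewrite (polE hs Eh) mulrA xh -!mulrA ps_comm // /s mulrDl mulrDr mulr1 mul1r.
by rewrite expr2 mulrA xh -!mulrA xh.
Qed.

Lemma pol_anticomm h x : filt 1 (h ^+ 2 + 1) -> x * h = - (h * x) ->
  x * pol h = - (pol h * x).
Proof.
set s := h ^+ 2 + 1 => hs xh; have Eh : h ^+ 2 = s - 1 by rewrite addrK.
rewrite (polE hs Eh) mulrA xh mulNr -!mulrA ps_comm // /s mulrDl mulrDr mulr1 mul1r.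
by rewrite expr2 mulrA xh mulNr -!mulrA xh mulrN opprK.
Qed.

Lemma sqr_near h q : q ^+ 2 = -1 -> filt 1 (h - q) -> filt 1 (h ^+ 2 + 1).
Proof.
move=> q2 hq; rewrite -[1]opprK -q2 !expr2; exact: filt_mulB.
Qed.

(** Commuting roots of [-1] that are congruent modulo [filt 1] coincide, because the
    other factor of [(pol h - q) * (pol h + q) = 0] is a unit. *)
Lemma pol_unique h q : q ^+ 2 = -1 -> q * h = h * q -> filt 1 (h - q) -> pol h = q.
Proof.
move=> q2 qh hq; have hs := sqr_near q2 hq.
have qp : q * pol h = pol h * q by apply: pol_comm.
have nq : filt 1 (pol h - q) by apply: filt_trans (pol_near hs) hq.
have E : (pol h - q) * (pol h + q) = 0.
  by rewrite mulrDr !mulrBl qp -!expr2 (pol_sqr hs) q2 addrA subrK subrr.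
(* chosen such that [pol h + q = 2 q (1 - s)], which is a unit *)
pose s := 2^-1 *: (pol h - q) * q.
have hs1 : filt 1 s by apply/filtMr/filtZ.
have qs : q * s = 2^-1 *: (q - pol h).
  rewrite /s -scalerAl -scalerAr mulrA mulrBr qp -mulrBl -mulrA -expr2 q2.
  by rewrite mulrN1 opprB.
have E2 : pol h + q = 2 *: (q * (1 - s)).
  rewrite mulrBr mulr1 qs scalerBr scalerA divff ?pnatr_eq0 // scale1r.
  by rewrite scaler_nat mulr2n opprB [RHS]addrC addrA subrK.
have u : (1 - s) * ps (GRing.exp 1) s = 1 by have := ps_geom 1 hs1; rewrite scale1r.
have : (pol h - q) * (pol h + q) * (ps (GRing.exp 1) s * q) = 0 by rewrite E mul0r.
rewrite E2 -scalerAr -scalerAl -mulrA -[q * _ * _]mulrA [(1 - s) * _]mulrA u mul1r -expr2 q2.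
rewrite mulrN1 scalerN => /eqP; rewrite oppr_eq0 scaler_eq0 pnatr_eq0 /= subr_eq0.
by move/eqP.
Qed.

End Pol.

(** * Parity with respect to a square root of -1 *)

Section Parity.
Variables (R : realType) (A : convAlg R).
Implicit Types (b c e : bool) (p q x y : A).

(** The eigenvectors of the conjugation by [q]: [x] commutes with [q] if [b] is
    false, and anticommutes with it otherwise. If [q ^ 2 = -1], the map [part b q] is
    the projection onto them. *)
Definition parity b q x := q * x = (-1) ^+ b *: (x * q).

Lemma partE b q x : q * q = -1 ->
  part b q x = 2^-1 *: (x - (-1) ^+ b *: (q * x * q)).
Proof.
move=> q2; rewrite /part (ainvN1 q2) !mulNr.
by case: b; rewrite /= ?expr1 ?expr0 ?scaleN1r ?scale1r ?opprK.
Qed.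

Lemma part_lin b q (a : R) x y :
  part b q (a *: x + y) = a *: part b q x + part b q y.
Proof.
rewrite /part scalerA [a * _]mulrC -scalerA -scalerDr; congr (_ *: _).
rewrite mulrDr mulrDl -scalerAr -scalerAl.
by case: b; rewrite ?opprD addrACA (scalerBr, scalerDr).
Qed.

Lemma part_filt b q m x : filt m x -> filt m (part b q x).
Proof.
move=> hx; apply: filtZ.
by case: b; [apply: filtB | apply: filtD] => //; apply/filtMr/filtMl.
Qed.

Lemma part_add q x : part false q x + part true q x = x.
Proof.
rewrite /part /= -scalerDr addrACA subrr addr0 -mulr2n -[x *+ 2]scaler_nat scalerA.
by rewrite mulVf ?scale1r // pnatr_eq0.
Qed.

Lemma parity_part b q x : q * q = -1 -> parity b q (part b q x).
Proof.
move=> q2; rewrite /parity partE // -scalerAr -scalerAl scalerA mulrC -scalerA.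
congr (_ *: _); rewrite mulrBr mulrBl -scalerAr -scalerAl -[q * x * q * q]mulrA.
rewrite !mulrA q2 -[q * x * q * q]mulrA q2 scalerBr scalerA -expr2 sqrr_sign scale1r.
by rewrite !mulN1r !mulrN1 !mulNr scalerN !opprK addrC.
Qed.

Lemma parity_part_keep b c e p q x : q * q = -1 ->
  parity e p q -> parity b p x -> parity b p (part c q x).
Proof.
rewrite /parity => q2 pq px; rewrite partE // -scalerAr -scalerAl scalerA mulrC -scalerA.
congr (_ *: _); rewrite mulrBr mulrBl scalerBr px; congr (_ - _).
rewrite -scalerAr -scalerAl scalerA mulrC -scalerA; congr (_ *: _).
rewrite !mulrA pq -!scalerAl -[q * p * x]mulrA px -scalerAr -scalerAl scalerA.
rewrite -!mulrA pq -!scalerAr scalerA; congr (_ *: _).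
by rewrite mulrAC -expr2 sqrr_sign mul1r.
Qed.

Lemma part_parity b c q x : q * q = -1 -> parity b q x ->
  part c q x = if c == b then x else 0.
Proof.
rewrite /parity => q2 qx; rewrite partE // qx -scalerAl -mulrA q2 mulrN1 !scalerN opprK scalerA.
have E : x + x = 2 *: x by rewrite scaler_nat mulr2n.
case: b c {qx} => [] []; rewrite ?(mulr1, mul1r, mulN1r, opprK, expr0, expr1) ?scaleN1r ?scale1r;
  rewrite ?subrr ?scaler0 // E scalerA mulVf ?scale1r ?pnatr_eq0 //.
Qed.

Lemma part_mulr b p q x : p * p = -1 -> parity true p q ->
  part b p (x * q) = part (~~ b) p x * q.
Proof.
rewrite /parity expr1 scaleN1r => p2 pq; rewrite !partE // -scalerAl mulrBl; congr (_ *: (_ - _)).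
have qp : q * p = - (p * q) by rewrite pq opprK.
rewrite -scalerAl -!mulrA qp !mulrN.
by case: b; rewrite /= ?expr0 ?expr1 ?scale1r ?scaleN1r ?opprK.
Qed.

Lemma part_near p q x y : p * p = -1 -> q * q = -1 ->
  filt 1 (p - q) -> filt 1 (x - y) -> parity true q y -> filt 1 (part true p x - y).
Proof.
move=> p2 q2 hp hx qy.
rewrite -[y in X in filt 1 X](part_parity true q2 qy) // !partE // -scalerBr; apply: filtZ.
rewrite !expr1 !scaleN1r !opprK opprD addrACA; apply: filtD => //.
by apply: filt_mulB => //; apply: filt_mulB.
Qed.

Lemma part_sign b c q x : q * q = -1 -> part b ((-1) ^+ c *: q) x = part b q x.
Proof.
move=> q2; rewrite !partE //; last first.
  by rewrite -scalerAl -scalerAr scalerA -expr2 sqrr_sign scale1r.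
by rewrite -!scalerAl -scalerAr [(-1) ^+ c *: (_ *: _)]scalerA -expr2 sqrr_sign scale1r.
Qed.

End Parity.

Lemma filtered_part (R : realType) (A B : convAlg R) (f : {lrmorphism A -> B}) b (q x : A) :
  q * q = -1 -> f (part b q x) = part b (f q) (f x).
Proof.
move=> q2; rewrite !partE //; last by rewrite -rmorphM q2 rmorphN1.
by rewrite linearZ /= raddfB /= linearZ /= !rmorphM.
Qed.

(** * Clifford systems and iterated components *)

Section CliffordSystems.
Variables (R : realType) (n : nat) (A : convAlg R).
Implicit Types (a q r : {ffun 'I_n -> A}) (x y : A) (l : seq 'I_n) (i : 'I_n -> bool).

Lemma tfiltBP m a q : tfilt m (a - q) <-> forall k, filt m (a k - q k).
Proof. by split=> h k; have := h k; rewrite !ffunE. Qed.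

Lemma clifford_sqr q k : clifford q -> q k * q k = -1.
Proof.
move=> /(_ k k); rewrite eqxx mulr1n => E.
have half (x : A) : 2^-1 *: (x + x) = x.
  by rewrite -mulr2n -[x *+ 2]scaler_nat scalerA mulVf ?scale1r // pnatr_eq0.
by rewrite -[LHS]half E -[in RHS](half 1) -scalerN opprD.
Qed.

Lemma clifford_anti q j k : clifford q -> j != k -> q j * q k = - (q k * q j).
Proof.
move=> cq /negPf jk; have := cq j k; rewrite jk mulr0n oppr0 => /eqP.
by rewrite addr_eq0 => /eqP.
Qed.

Lemma clifford_parity q j k : clifford q -> parity (j != k) (q j) (q k).
Proof.
move=> cq; rewrite /parity; case: eqVneq => [->|jk]; first by rewrite expr0 scale1r.
by rewrite expr1 scaleN1r clifford_anti.
Qed.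

Lemma cliffordI q : (forall k, q k * q k = -1) ->
  (forall j k, j != k -> parity true (q j) (q k)) -> clifford q.
Proof.
move=> h1 h2 j k; case: eqVneq => [->|jk]; first by rewrite h1 mulr1n opprD.
by rewrite (h2 j k jk) expr1 scaleN1r addNr oppr0.
Qed.

(** The index is an arbitrary function, because Gram-Schmidt uses constant ones. *)
Definition parts q (i : 'I_n -> bool) l x := foldl (fun x k => part (i k) (q k) x) x l.

Lemma parts_lin q i l (c : R) x y :
  parts q i l (c *: x + y) = c *: parts q i l x + parts q i l y.
Proof. by elim: l x y => //= k l IH x y; rewrite part_lin IH. Qed.

Lemma partsD q i l x y : parts q i l (x + y) = parts q i l x + parts q i l y.
Proof. by rewrite -[x]scale1r parts_lin !scale1r. Qed.

Lemma parts0 q i l : parts q i l 0 = 0.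
Proof. by have := parts_lin q i l (-1) 0 0; rewrite scaler0 addr0 scaleN1r addNr. Qed.

Lemma partsB q i l x y : parts q i l (x - y) = parts q i l x - parts q i l y.
Proof. by rewrite addrC -scaleN1r parts_lin scaleN1r addrC. Qed.

Lemma parts_sum q i l (I : Type) (s : seq I) (P : pred I) (F : I -> A) :
  parts q i l (\sum_(k <- s | P k) F k) = \sum_(k <- s | P k) parts q i l (F k).
Proof. by rewrite (big_morph _ (partsD q i l) (parts0 q i l)). Qed.

Lemma parts_filt q i l m x : filt m x -> filt m (parts q i l x).
Proof. by elim: l x => //= k l IH x hx; apply/IH/part_filt. Qed.

Lemma parts_keep q i l b p x : {in l, forall k, q k * q k = -1} ->
  (forall k, k \in l -> exists e, parity e p (q k)) ->
  parity b p x -> parity b p (parts q i l x).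
Proof.
elim: l x => //= k l IH x q2 hl hx; apply: IH.
- by move=> m ml; apply: q2; rewrite inE ml orbT.
- by move=> m ml; apply: hl; rewrite inE ml orbT.
have [e he] := hl k (mem_head _ _).
by apply: parity_part_keep he hx; apply: q2; rewrite mem_head.
Qed.

Lemma parity_parts q i l k x : {in l, forall j, q j * q j = -1} ->
  (forall j, j \in l -> exists e, parity e (q k) (q j)) -> k \in l ->
  parity (i k) (q k) (parts q i l x).
Proof.
elim: l x => //= j l IH x q2 hl; rewrite inE.
have q2' : {in l, forall j, q j * q j = -1} by move=> m ml; apply: q2; rewrite inE ml orbT.
have hl' m : m \in l -> exists e, parity e (q k) (q m).
  by move=> ml; apply: hl; rewrite inE ml orbT.
case/predU1P => [kj|kl]; last exact: IH.
by subst k; apply: parts_keep => //; apply/parity_part/q2/mem_head.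
Qed.

Lemma parts_parity q i (j : 'I_n -> bool) l x : (forall k, q k * q k = -1) ->
  (forall k, k \in l -> parity (j k) (q k) x) ->
  parts q i l x = if all (fun k => i k == j k) l then x else 0.
Proof.
move=> q2; elim: l => //= k l IH hx; rewrite (part_parity (i k) (q2 k) (hx k (mem_head _ _))).
case: eqP => _ /=; last exact: parts0.
by apply: IH => m ml; apply: hx; rewrite inE ml orbT.
Qed.

Lemma parts_mulr q i l m x : clifford q -> m \notin l ->
  parts q i l (x * q m) = parts q (fun k => ~~ i k) l x * q m.
Proof.
move=> cq; elim: l x => //= k l IH x; rewrite inE negb_or => /andP[mk ml].
rewrite part_mulr; [exact: IH | exact: clifford_sqr |].
by have := clifford_parity k m cq; rewrite eq_sym mk.
Qed.

Lemma eq_parts q i (i' : 'I_n -> bool) l x : {in l, i =1 i'} -> parts q i l x = parts q i' l x.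
Proof.
elim: l x => //= k l IH x h; rewrite h ?mem_head // IH // => m ml.
by apply: h; rewrite inE ml orbT.
Qed.

(** The two projections for one [k] add up to the identity, so the sum halves with
    each element of [l] when [i] is paired with the index that differs from it only at
    the head of [l]. *)
Lemma sum_parts q l x : uniq l ->
  \sum_(i : mindex n) parts q i l x = 2 ^+ n / 2 ^+ size l *: x.
Proof.
elim: l x => [|k l IH] x /=.
  by move=> _; rewrite sumr_const card_ffun card_bool card_ord divr1 -natrX scaler_nat.
case/andP=> kl ul.
pose fl (i : mindex n) : mindex n := [ffun j => if j == k then ~~ i j else i j].
have flK : involutive fl.
  by move=> i; apply/ffunP => j; rewrite !ffunE; case: eqP => // _; rewrite negbK.
(* [i] and [fl i] agree on [l], so the two terms differ only in the part at [k] *)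
have E (i : mindex n) : parts q i l (part (i k) (q k) x) + parts q (fl i) l (part (fl i k) (q k) x)
    = parts q i l x.
  rewrite (@eq_parts q (fl i) i); last first.
    by move=> j jl; rewrite ffunE; case: eqP => // jk; rewrite -jk jl in kl.
  rewrite -partsD ffunE eqxx; congr parts.
  by case: (i k); rewrite /= ?part_add // addrC part_add.
set S := LHS; have E2 : S + S = \sum_(i : mindex n) parts q i l x.
  rewrite {2}/S (reindex_inj (inv_inj flK)) -big_split; apply: eq_bigr => i _; exact: E.
have -> : S = 2^-1 *: (S + S).
  by rewrite -mulr2n -[S *+ 2]scaler_nat scalerA mulVf ?scale1r // pnatr_eq0.
by rewrite E2 IH // scalerA exprS invfM mulrCA.
Qed.

Lemma tdivE r q (i : mindex n) j : tdiv r q i j = parts q i (enum 'I_n) (r j * ainv (q j)).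
Proof. by []. Qed.

Lemma tdiv_parity r q (i : mindex n) j k : clifford q -> parity (i k) (q k) (tdiv r q i j).
Proof.
move=> cq; apply: parity_parts; [|by move=> m _; exists (k != m); apply: clifford_parity|by rewrite mem_enum].
by move=> m _; apply: clifford_sqr.
Qed.

Lemma tdiv_filt m r q (i : mindex n) j : tfilt m r -> filt m (tdiv r q i j).
Proof. by move=> hr; apply/parts_filt/filtMr. Qed.

Lemma sum_tdiv r q j : clifford q -> r j = (\sum_(i : mindex n) tdiv r q i j) * q j.
Proof.
move=> cq; rewrite sum_parts ?enum_uniq // size_enum_ord divff ?scale1r; last first.
  by rewrite expf_neq0 ?pnatr_eq0.
by rewrite (ainvN1 (clifford_sqr j cq)) -mulrA mulNr clifford_sqr // opprK mulr1.
Qed.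

End CliffordSystems.

(** * The Gram-Schmidt system *)

Section GramSchmidt.
Variables (R : realType) (n : nat) (A : convAlg R).
Implicit Types (a q r : {ffun 'I_n -> A}) (x y : A) (k : 'I_n).

Let tt : 'I_n -> bool := fun=> true.

(** The vector of which [pol] is taken in the [k]-th step, when the vectors already
    constructed are the [q j] with [j < k]. *)
Definition GS_residue q a k := parts q tt (take k (enum 'I_n)) (a k).

Lemma mem_take_enum (j k : 'I_n) : (j \in take k (enum 'I_n)) = (j < k)%N.
Proof.
by rewrite in_take_leq ?mem_enum ?index_enum_ord // size_enum_ord ltnW.
Qed.

Lemma take_enumS k : take k.+1 (enum 'I_n) = rcons (take k (enum 'I_n)) k.
Proof. by rewrite (take_nth k) ?size_enum_ord // nth_ord_enum. Qed.

Lemma GS_stepE q a k :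
  GS_step [seq q j | j <- take k (enum 'I_n)] (a k) =
  rcons [seq q j | j <- take k (enum 'I_n)] (pol (GS_residue q a k)).
Proof.
rewrite /GS_step; congr (rcons _ (pol _)).
rewrite /GS_residue /parts; elim: (take _ _) (a k) => //= j l IH x; exact: IH.
Qed.

Lemma GS_unique_rec q a :
  (forall k, q k = pol (GS_residue q a k)) -> GS a = q.
Proof.
move=> h.
have H m : (m <= n)%N -> foldl (@GS_step R A) [::] [seq a j | j <- take m (enum 'I_n)]
    = [seq q j | j <- take m (enum 'I_n)].
  elim: m => [|m IH] hm; first by rewrite take0.
  have := take_enumS (Ordinal hm); rewrite /= => ->.
  by rewrite !map_rcons foldl_rcons IH ?(ltnW hm) // (GS_stepE q a (Ordinal hm)) -h.
apply/ffunP => k; rewrite ffunE.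
have := H n (leqnn n); rewrite take_oversize ?size_enum_ord // => ->.
by rewrite (nth_map k) ?size_enum_ord // nth_ord_enum.
Qed.

Lemma foldl_GS_step (s t : seq A) :
  size (foldl (@GS_step R A) s t) = (size s + size t)%N /\
  take (size s) (foldl (@GS_step R A) s t) = s.
Proof.
elim: t s => [|x t IH] s /=; first by rewrite addn0 take_size.
have [h1 h2] := IH (GS_step s x); split; first by rewrite h1 size_rcons addSnnS.
have := congr1 (take (size s)) h2; rewrite size_rcons take_takel // => ->.
by rewrite /GS_step -cats1 take_size_cat.
Qed.

(** The vectors constructed in the first steps are not changed by later ones, so the
    algorithm is the recursion [q k = pol (GS_residue q a k)]. *)
Lemma GS_rec a k : GS a k = pol (GS_residue (GS a) a k).
Proof.
have H m : (m <= n)%N -> foldl (@GS_step R A) [::] [seq a j | j <- take m (enum 'I_n)]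
    = [seq GS a j | j <- take m (enum 'I_n)].
  move=> hm; set s := [seq a j | j <- take m (enum 'I_n)].
  have ss : size s = m by rewrite size_map size_take size_enum_ord; case: ltngtP hm.
  pose L := foldl (@GS_step R A) [::] [seq a j | j <- enum 'I_n].
  have sL : size L = n.
    by have [-> _] := foldl_GS_step [::] [seq a j | j <- enum 'I_n]; rewrite size_map size_enum_ord.
  have -> : foldl (@GS_step R A) [::] s = take m L.
    rewrite /L -(cat_take_drop m (enum 'I_n)) map_cat foldl_cat -/s.
    have [h1 h2] := foldl_GS_step (foldl (@GS_step R A) [::] s) [seq a j | j <- drop m (enum 'I_n)].
    rewrite -[LHS]h2; congr take.
    by have [-> _] := foldl_GS_step [::] s.
  rewrite map_take; congr take; apply: (@eq_from_nth _ 0).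
    by rewrite size_map size_enum_ord.
  move=> i; rewrite sL => hi; rewrite (nth_map (Ordinal hi)) ?size_enum_ord // ffunE.
  by congr nth; rewrite -[i in RHS]/(nat_of_ord (Ordinal hi)) nth_ord_enum.
have := H k.+1 (ltn_ord k); rewrite take_enumS map_rcons foldl_rcons H ?(ltnW (ltn_ord k)) //.
by rewrite GS_stepE map_rcons => /rcons_inj [].
Qed.

(** These conditions characterize [GS a] (see [GS_spec_unique] and [GS_specP]).
    They are preserved by morphisms and sign changes, and they hold for [q] in place
    of [a], which is how such properties of [GS] are obtained below. *)
Definition GS_spec a q := [/\ clifford q, tfilt 1 (a - q)
  & forall k, parity false (q k) (GS_residue q a k)].

Lemma GS_spec_near a q : GS_spec a q -> near_clifford a.
Proof. by case=> cq hq _; exists q. Qed.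

Lemma GS_residue_self q k : clifford q -> GS_residue q q k = q k.
Proof.
move=> cq; rewrite /GS_residue (@parts_parity _ _ _ _ _ tt).
- by rewrite (_ : all _ _) //; apply/allP.
- by move=> j; apply: clifford_sqr.
move=> j; rewrite mem_take_enum => jk; have := clifford_parity j k cq.
by rewrite neq_ltn jk.
Qed.

(** The residue commutes with [q k] and is congruent to it, because [q k] is its own
    residue; hence [pol] maps it to [q k] by [pol_unique]. *)
Lemma GS_spec_unique a q : GS_spec a q -> GS a = q.
Proof.
case=> cq hq hc; apply: GS_unique_rec => k; apply/esym/pol_unique.
- by rewrite expr2 clifford_sqr.
- by have := hc k; rewrite /parity expr0 scale1r.
rewrite -[X in _ - X](GS_residue_self k cq) -partsB; apply: parts_filt.
by have := hq k; rewrite !ffunE.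
Qed.

(** By induction on [k], the residue anticommutes with the previous vectors and is
    congruent to [p k], where [p] is a Clifford system near [a]. Both properties pass
    to its polar part. *)
Lemma GS_specP a : near_clifford a -> GS_spec a (GS a).
Proof.
case=> p cp hp; set q := GS a.
have H m : (m <= n)%N -> forall k, (k < m)%N ->
    [/\ q k * q k = -1, filt 1 (q k - p k),
       (forall j : 'I_n, (j < k)%N -> parity true (q j) (q k)) & parity false (q k) (GS_residue q a k)].
  elim: m => // m IH hm k; rewrite ltnS leq_eqVlt => /predU1P[km|]; last first.
    by apply: IH; apply: ltnW.
  have {}IH (j : 'I_n) : (j < k)%N -> [/\ q j * q j = -1, filt 1 (q j - p j),
    (forall i : 'I_n, (i < j)%N -> parity true (q i) (q j)) & parity false (q j) (GS_residue q a j)].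
    by rewrite km; apply: IH; apply: ltnW.
  set h := GS_residue q a k.
  have near_h : filt 1 (h - p k).
    have : filt 1 (a k - p k) by have := hp k; rewrite !ffunE.
    have : {in take k (enum 'I_n), forall j : 'I_n, (j < k)%N} by move=> j; rewrite mem_take_enum.
    rewrite /h /GS_residue /parts; elim: (take _ _) (a k) => //= j l IHl x hl hx.
    have jk : (j < k)%N by apply: hl; rewrite mem_head.
    apply: IHl; first by move=> i il; apply: hl; rewrite inE il orbT.
    have [q2 qp _ _] := IH j jk; apply: (part_near q2 (clifford_sqr j cp)) => //.
    by have := clifford_parity j k cp; rewrite neq_ltn jk.
  have h2 := sqr_near (etrans (expr2 _) (clifford_sqr k cp)) near_h.
  have qk : q k = pol h by rewrite /q GS_rec.
  split.
  - by rewrite qk -expr2 pol_sqr.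
  - by rewrite qk; apply: filt_trans (pol_near h2) near_h.
  - move=> j jk; rewrite qk /parity expr1 scaleN1r; apply: pol_anticomm => //; rewrite -scaleN1r.
    apply: (parity_parts tt); rewrite ?mem_take_enum // => i; rewrite mem_take_enum => ik.
      by have [] := IH i ik.
    exists (i != j); rewrite eq_sym; case: (ltngtP i j) => [ij|ij|/val_inj ->].
    - have [_ _ /(_ i ij) + _] := IH j jk; rewrite neq_ltn ij orbT /parity !expr1 !scaleN1r => ->.
      by rewrite opprK.
    - by have [_ _ /(_ j ij)] := IH i ik; rewrite neq_ltn ij.
    by rewrite eqxx /parity expr0 scale1r.
  rewrite qk -/h /parity expr0 scale1r; apply/esym; exact: pol_comm.
have {}H k := H n (leqnn n) k (ltn_ord k).
split; last by move=> k; have [] := H k.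
- apply: cliffordI => [k|j k jk]; first by have [] := H k.
  have [jk'|] := ltnP j k; first by have [_ _ h _] := H k; apply: h.
  rewrite leq_eqVlt eq_sym => /predU1P[/val_inj kj|kj]; first by rewrite kj eqxx in jk.
  have [_ _ h _] := H j; have := h _ kj.
  by rewrite /parity !expr1 !scaleN1r => ->; rewrite opprK.
apply/tfiltBP => k; have [_ h _ _] := H k.
by apply: filt_trans (filtBC h); move/tfiltBP: hp.
Qed.

End GramSchmidt.

(** * The Gram-Schmidt remainder *)

Section GramSchmidtRemainder.
Variables (R : realType) (n : nat) (A : convAlg R).
Implicit Types (a q r : {ffun 'I_n -> A}) (i : mindex n).

(** If [j] is the first index of [i], the projections for the [k <= j] already
    annihilate [(a j - q j) / q j]: right multiplication by [q j] exchanges the two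
    parts with respect to the [q k] with [k < j], and turns the condition that the
    residue commutes with [q j] into the vanishing of the odd part. *)
Lemma tdiv_first a q i j : GS_spec a q -> is_first j i -> tdiv (a - q) q i j = 0.
Proof.
case=> cq _ /(_ j) hc /andP[ij /forallP first].
have q2 := clifford_sqr _ cq.
rewrite tdivE -(cat_take_drop j (enum 'I_n)) /parts foldl_cat.
rewrite -!/(parts _ _ _ _) (drop_nth j) ?size_enum_ord // nth_ord_enum /= -/(parts _ _ _ _).
rewrite (_ : part _ _ _ = 0) ?parts0 // (ainvN1 (q2 j)) mulrN -mulNr.
have jl : j \notin take j (enum 'I_n) by rewrite mem_take_enum ltnn.
rewrite parts_mulr // (@eq_parts _ _ _ _ _ (fun=> true)); last first.
  move=> k; rewrite mem_take_enum => kj; have := first k.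
  by case: (i k) => //=; rewrite leqNgt kj.
have -> : - (a - q) j = q j - a j by rewrite !ffunE opprB.
rewrite partsB -/(GS_residue q q j) -/(GS_residue q a j) GS_residue_self //.
rewrite (@part_parity _ _ false) ?ij //.
move: hc; rewrite /parity !expr0 !scale1r => hc.
by rewrite mulrA mulrBr hc -mulrBl.
Qed.

Lemma GS_clifford q : clifford q -> GS q = q.
Proof.
move=> cq; apply: GS_spec_unique; split=> //.
  by apply/tfiltBP => k; rewrite subrr; apply: filt_zero.
by move=> k; rewrite GS_residue_self // /parity expr0 scale1r.
Qed.

Lemma clifford_tsign i q : clifford q -> clifford (tsign i q).
Proof.
move=> cq; apply: cliffordI => [k|j k jk]; rewrite !ffunE /parity -!scalerAl -!scalerAr.
  by rewrite scalerA -expr2 sqrr_sign scale1r clifford_sqr.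
have := clifford_parity j k cq; rewrite /parity jk => ->.
by rewrite !scalerA; congr (_ *: _); ring.
Qed.

Lemma parts_tsign (i : mindex n) q (f : 'I_n -> bool) l x : clifford q ->
  parts (tsign i q) f l x = parts q f l x.
Proof.
move=> cq; elim: l x => //= k l IH x; rewrite IH ffunE part_sign //.
exact: clifford_sqr.
Qed.

Lemma GS_tsign i a : near_clifford a -> GS (tsign i a) = tsign i (GS a).
Proof.
move=> /GS_specP[cq hq hc]; apply: GS_spec_unique; split.
- exact: clifford_tsign.
- apply/tfiltBP => k; rewrite !(ffunE (fun k => _ *: _)) -scalerBr; apply: filtZ.
  by move/tfiltBP: hq.
move=> k; rewrite /GS_residue parts_tsign // ![tsign _ _ _]ffunE.
have := parts_lin (GS a) (fun=> true) (take k (enum 'I_n)) ((-1) ^+ i k) (a k) 0.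
rewrite parts0 !addr0 => ->; move: (hc k).
rewrite /parity /GS_residue => h.
by rewrite -!scalerAl -!scalerAr h !expr0 !scale1r.
Qed.

Lemma tsignB i a q : tsign i (a - q) = tsign i a - tsign i q.
Proof. by apply/ffunP => k; rewrite !ffunE scalerBr. Qed.

Lemma tdiv_tsign i r q j k : clifford q ->
  tdiv (tsign i r) (tsign i q) j k = tdiv r q j k.
Proof.
move=> cq; rewrite !tdivE parts_tsign // !ainvN1; last first.
- by apply: clifford_sqr; apply: clifford_tsign.
- exact: clifford_sqr.
rewrite !ffunE -scalerN -scalerAl -scalerAr scalerA -expr2 sqrr_sign scale1r.
by [].
Qed.

End GramSchmidtRemainder.

Section GramSchmidtNatural.
Variables (R : realType) (n : nat) (A B : convAlg R) (f : {lrmorphism A -> B}).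
Hypothesis hf : forall i x, filt i x -> filt i (f x).
Implicit Types (a q r : {ffun 'I_n -> A}).

Local Notation F a := [ffun k => f (a k)].

Lemma clifford_morph q : clifford q -> clifford (F q).
Proof.
move=> cq j k; rewrite !ffunE -!rmorphM -raddfD cq raddfN /= -mulr_natr rmorphM /=.
by rewrite !rmorph_nat mulr_natr.
Qed.

Lemma tfilt_morph m q : tfilt m q -> tfilt m (F q).
Proof. by move=> h k; rewrite ffunE; apply: hf. Qed.

Lemma morphB a q : F (a - q) = F a - F q.
Proof. by apply/ffunP => k; rewrite !ffunE raddfB. Qed.

Lemma near_clifford_morph a : near_clifford a -> near_clifford (F a).
Proof.
case=> q cq hq; exists (F q); first exact: clifford_morph.
by rewrite -morphB; apply: tfilt_morph.
Qed.

Lemma parts_morph q (i : 'I_n -> bool) l x : clifford q ->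
  f (parts q i l x) = parts (F q) i l (f x).
Proof.
move=> cq; elim: l x => //= k l IH x; rewrite IH ffunE filtered_part //.
exact: clifford_sqr.
Qed.

Lemma tdiv_morph r q i j : clifford q -> f (tdiv r q i j) = tdiv (F r) (F q) i j.
Proof.
move=> cq; rewrite !tdivE parts_morph // !ainvN1; last first.
- exact: clifford_sqr.
- by apply: clifford_sqr; apply: clifford_morph.
by rewrite !ffunE rmorphM /= raddfN.
Qed.

Lemma GS_morph a : near_clifford a -> GS (F a) = F (GS a).
Proof.
move=> /GS_specP[cq hq hc]; apply: GS_spec_unique; split.
- exact: clifford_morph.
- by rewrite -morphB; apply: tfilt_morph.
move=> k; rewrite /GS_residue [F a k]ffunE -parts_morph //.
have := congr1 f (hc k); rewrite /parity linearZ /= !rmorphM.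
by rewrite [F (GS a) k]ffunE.
Qed.

End GramSchmidtNatural.

(** * Skew power series *)

Section SkewSeries.
Variables (R : realType) (C : algType R) (L : finType) (tau : L -> {lrmorphism C -> C}).
Implicit Types (w v : seq L) (c : C) (f g h : seq L -> C).

Definition twist w c : C := foldl (fun c x => tau x c) c w.

Lemma twist_lin w (a : R) b c : twist w (a *: b + c) = a *: twist w b + twist w c.
Proof. by elim: w b c => //= x w IH b c; rewrite linearP IH. Qed.

Lemma twistM w b c : twist w (b * c) = twist w b * twist w c.
Proof. by elim: w b c => //= x w IH b c; rewrite rmorphM IH. Qed.

Lemma twist0 w : twist w 0 = 0.
Proof. by elim: w => //= x w IH; rewrite raddf0. Qed.

Lemma twist1 w : twist w 1 = 1.
Proof. by elim: w => //= x w IH; rewrite rmorph1. Qed.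

(** The function [f] stands for the series [\sum_w x_w f(w)] over the words [w] in [L],
    for the multiplication with [c * x_l = x_l * tau l c]; the parameter [t] is there for
    the ring structure to depend on it. *)
Definition skew (t : L -> {lrmorphism C -> C}) : Type := seq L -> C.

Local Notation F := (skew tau).

HB.instance Definition _ := GRing.Lmodule.copy F (seq L -> C).

(** The term of [w] collects the factorizations [w = u v], which are enumerated by
    recursion on [w]: either [u] is empty, or it begins with the first letter of [w]. *)
Fixpoint skew_mul f g w : C :=
  twist w (f [::]) * g w + (if w is x :: w' then skew_mul (fun v => f (x :: v)) g w' else 0).

Definition skewC c : F := fun w => if w is [::] then c else 0.

Lemma skew_mul_linl (a : R) f1 f2 g w :
  skew_mul (fun v => a *: f1 v + f2 v) g w = a *: skew_mul f1 g w + skew_mul f2 g w.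
Proof.
elim: w f1 f2 => [|x w IH] f1 f2 /=; first by rewrite !addr0 mulrDl scalerAl.
by rewrite linearP twist_lin mulrDl -scalerAl IH scalerDr addrACA.
Qed.

Lemma skew_mul_linr (a : R) f g1 g2 w :
  skew_mul f (fun v => a *: g1 v + g2 v) w = a *: skew_mul f g1 w + skew_mul f g2 w.
Proof.
elim: w f => [|x w IH] f /=; first by rewrite !addr0 mulrDr scalerAr.
by rewrite mulrDr -scalerAr IH scalerDr addrACA.
Qed.

Lemma skew_mul0l g w : skew_mul (fun=> 0) g w = 0.
Proof. by elim: w => [|x w IH] /=; rewrite ?IH ?raddf0 ?twist0 mul0r addr0. Qed.

Lemma skew_mulCl c g w : skew_mul (skewC c) g w = twist w c * g w.
Proof. by case: w => [|x w] /=; rewrite ?skew_mul0l addr0. Qed.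

Lemma skew_mulCr c f w : skew_mul f (skewC c) w = f w * c.
Proof. by elim: w f => [|x w IH] f /=; rewrite ?addr0 // mulr0 add0r IH. Qed.

(** Associativity of the product for a constant first factor [c]. *)
Lemma skew_mul_twist c g h w :
  skew_mul (fun v => twist v c * g v) h w = twist w c * skew_mul g h w.
Proof.
elim: w c g => [|x w IH] c g /=; first by rewrite !addr0 mulrA.
by rewrite rmorphM twistM IH mulrDr mulrA.
Qed.

Lemma skew_mulA f g h w :
  skew_mul f (skew_mul g h) w = skew_mul (skew_mul f g) h w.
Proof.
elim: w f => [|x w IH] f /=; first by rewrite !addr0 mulrA.
rewrite IH addr0 rmorphM twistM mulrDr mulrA -addrA; congr (_ + _).
have := skew_mul_linl 1 (fun v => twist v (tau x (f [::])) * g (x :: v))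
  (skew_mul (fun v => f (x :: v)) g) h w.
rewrite scale1r skew_mul_twist => <-; congr skew_mul.
by apply/funext => v; rewrite scale1r.
Qed.

Fact skew_mulA' : associative (skew_mul : F -> F -> F).
Proof. by move=> f g h; apply/funext => w; apply: skew_mulA. Qed.
Fact skew_mul1l : left_id (skewC 1) (skew_mul : F -> F -> F).
Proof. by move=> f; apply/funext => w; rewrite skew_mulCl twist1 mul1r. Qed.
Fact skew_mul1r : right_id (skewC 1) (skew_mul : F -> F -> F).
Proof. by move=> f; apply/funext => w; rewrite skew_mulCr mulr1. Qed.
Fact skew_mulDl : left_distributive (skew_mul : F -> F -> F) +%R.
Proof.
move=> f g h; apply/funext => w.
transitivity (1 *: skew_mul f h w + skew_mul g h w); last by rewrite scale1r.
by rewrite -skew_mul_linl; congr skew_mul; apply/funext => v; rewrite scale1r.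
Qed.
Fact skew_mulDr : right_distributive (skew_mul : F -> F -> F) +%R.
Proof.
move=> f g h; apply/funext => w.
transitivity (1 *: skew_mul f g w + skew_mul f h w); last by rewrite scale1r.
by rewrite -skew_mul_linr; congr skew_mul; apply/funext => v; rewrite scale1r.
Qed.
Fact skew_1neq0 : skewC 1 != 0 :> F.
Proof. by apply/eqP => /(congr1 (fun f : F => f [::])) /eqP; rewrite oner_eq0. Qed.

HB.instance Definition _ := GRing.Zmodule_isNzRing.Build F
  skew_mulA' skew_mul1l skew_mul1r skew_mulDl skew_mulDr skew_1neq0.

Fact skew_scalerAl (a : R) (f g : F) : a *: (f * g) = (a *: f) * g.
Proof.
apply/funext => w; transitivity (a *: skew_mul f g w + skew_mul (fun=> 0) g w).
  by rewrite skew_mul0l addr0.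
by rewrite -skew_mul_linl; congr skew_mul; apply/funext => v; rewrite addr0.
Qed.

HB.instance Definition _ := GRing.Lmodule_isLalgebra.Build R F skew_scalerAl.

Fact skew_scalerAr (a : R) (f g : F) : a *: (f * g) = f * (a *: g).
Proof.
apply/funext => w.
have E : skew_mul f (fun=> 0) w = 0.
  transitivity (skew_mul f (skewC 0) w); last by rewrite skew_mulCr mulr0.
  by congr skew_mul; apply/funext => -[].
transitivity (a *: skew_mul f g w + skew_mul f (fun=> 0) w).
  by rewrite E addr0.
by rewrite -skew_mul_linr; congr skew_mul; apply/funext => v; rewrite addr0.
Qed.

HB.instance Definition _ := GRing.Lalgebra_isAlgebra.Build R F skew_scalerAr.

End SkewSeries.

Section SkewConvenient.
Variables (R : realType) (C : algType R) (L : finType) (tau : L -> {lrmorphism C -> C}).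
Hypothesis C_findim : exists d (e : 'I_d -> C),
  forall c, exists b : 'I_d -> R, c = \sum_(k < d) b k *: e k.
Local Notation F := (skew tau).
Implicit Types (f g : F) (w v : seq L) (c : C).

Definition skew_filt (i : nat) : set F :=
  [set f : F | forall w, (size w < i)%N -> f w = 0]%classic.

Lemma skewDE f g w : (f + g) w = f w + g w. Proof. by []. Qed.
Lemma skewBE f g w : (f - g) w = f w - g w. Proof. by []. Qed.
Lemma skewZE (a : R) f w : (a *: f) w = a *: f w. Proof. by []. Qed.

Lemma skew_sumE (I : Type) (r : seq I) (P : pred I) (f : I -> F) w :
  (\sum_(k <- r | P k) f k) w = \sum_(k <- r | P k) f k w.
Proof. by elim/big_rec2: _ => // k y f' _ <-. Qed.

Fact skew_filt_all : skew_filt 0 = setT.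
Proof. by apply/seteqP; split. Qed.

Fact skew_filt_decr i : (skew_filt i.+1 `<=` skew_filt i)%classic.
Proof. by move=> f h w hw; apply/h/ltnW. Qed.

Fact skew_filt_zero i : skew_filt i 0.
Proof. by []. Qed.

Fact skew_filt_lin i (a : R) f g : skew_filt i f -> skew_filt i g -> skew_filt i (a *: f + g).
Proof. by move=> hf hg w hw; rewrite skewDE skewZE hf // hg // scaler0 addr0. Qed.

Fact skew_filt_mul i j f g : skew_filt i f -> skew_filt j g -> skew_filt (i + j) (f * g).
Proof.
move=> hf hg w; rewrite -[(f * g) w]/(skew_mul tau f g w).
elim: w i f hf => [|x w IH] [|i] f hf /= hw.
- by rewrite hg ?mulr0 ?addr0.
- by rewrite hf ?mul0r ?addr0.
- by rewrite hg // mulr0 add0r (IH 0%N) // ltnW.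
rewrite hf // raddf0 twist0 mul0r add0r (IH i) // => v hv; exact: hf.
Qed.

Fact skew_filt_separated f : (forall i, skew_filt i f) -> f = 0.
Proof. by move=> h; apply/funext => w; apply: (h (size w).+1). Qed.

Fact skew_filt_complete (u : nat -> F) :
  (forall i, exists N, forall m m', (N <= m)%N -> (N <= m')%N -> skew_filt i (u m - u m')) ->
  exists l, forall i, exists N, forall m, (N <= m)%N -> skew_filt i (u m - l).
Proof.
move=> /choice[N hN]; exists (fun w => u (N (size w).+1) w) => i; exists (N i) => m hm w hw.
rewrite skewBE.
(* [u] is stationary at [w] from [N (size w).+1] on, hence [u m w = u M w] *)
pose M := maxn m (N (size w).+1).
have /eqP := hN i m M hm (leq_trans hm (leq_maxl _ _)) w hw.
rewrite skewBE subr_eq0 => /eqP ->.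
exact: (hN (size w).+1 _ _ (leq_maxr _ _) (leqnn _) w (leqnn _)).
Qed.

Definition monomial v c : F := fun w => if w == v then c else 0.

Fact skew_filt_findim i : exists d (e : 'I_d -> F),
  forall f, exists c : 'I_d -> R, skew_filt i (f - \sum_(k < d) c k *: e k).
Proof.
have [d [e span]] := C_findim.
pose T : finType := (i.-bseq L * 'I_d)%type.
exists #|T|, (fun k : 'I_#|T| => let t : T := enum_val k in monomial t.1 (e t.2)) => f.
have [b hb] := choice (fun w : i.-bseq L => span (f w)).
exists (fun k : 'I_#|T| => let t : T := enum_val k in b t.1 t.2) => w hw.
rewrite -(big_enum_val (A := T) (fun t : T => b t.1 t.2 *: monomial t.1 (e t.2))) /=.
rewrite skewBE skew_sumE.
have -> : \sum_(t in T) (b t.1 t.2 *: monomial t.1 (e t.2)) w =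
    \sum_(v : i.-bseq L) \sum_(k < d) (b v k *: monomial v (e k)) w.
  by rewrite pair_bigA; apply: eq_bigl.
rewrite (bigD1 (Bseq (ltnW hw))) //= [X in _ - (_ + X)]big1 ?addr0 => [|v /eqP vw].
  apply/eqP; rewrite subr_eq0 (hb (Bseq (ltnW hw))) /=; apply/eqP/eq_bigr => k _.
  by rewrite skewZE /monomial eqxx.
apply: big1 => k _; rewrite skewZE /monomial; case: eqP => [wv|_]; last by rewrite scaler0.
by case: vw; apply: val_inj.
Qed.

Definition skewAlg : convAlg R :=
  ConvAlg skew_filt_all skew_filt_decr skew_filt_zero skew_filt_lin skew_filt_mul
    skew_filt_separated skew_filt_complete skew_filt_findim.

End SkewConvenient.

Section SkewMorphism.
Variables (R : realType) (C : algType R) (L : finType) (tau : L -> {lrmorphism C -> C}).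
Local Notation F := (skew tau).
Implicit Types (f g : F) (w v : seq L) (c : C) (l : L).

Definition skewX l : F := fun w => if w == [:: l] then 1 else 0.

Lemma skewCmulE c f w : (skewC tau c * f) w = twist tau w c * f w.
Proof. exact: skew_mulCl. Qed.

Lemma skewmulCE c f w : (f * skewC tau c) w = f w * c.
Proof. exact: skew_mulCr. Qed.

Lemma skewX_mulE l f w :
  (skewX l * f) w = if w is x :: v then if x == l then f v else 0 else 0.
Proof.
rewrite -[LHS]/(skew_mul tau (skewX l) f w); case: w => [|x v] /=; first by rewrite mul0r addr0.
rewrite raddf0 twist0 mul0r add0r /skewX.
case: eqVneq => [->|xl].
  transitivity (skew_mul tau (skewC tau 1) f v); last by rewrite skew_mulCl twist1 mul1r.
  by congr skew_mul; apply/funext => -[|y u]; rewrite eqseq_cons eqxx.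
rewrite -[RHS](skew_mul0l tau f v).
by congr skew_mul; apply/funext => u; rewrite eqseq_cons (negPf xl).
Qed.

Lemma skewC_X c l : skewC tau c * skewX l = skewX l * skewC tau (tau l c).
Proof.
apply/funext => w; rewrite skewCmulE skewmulCE /skewX.
by case: eqP => [->|_] /=; rewrite ?mulr1 ?mul1r // mulr0 mul0r.
Qed.

Variables (A : convAlg R) (psi : {lrmorphism C -> A}) (y : L -> A).
Hypothesis y_filt : forall l, filt 1 (y l).
Hypothesis psi_y : forall c l, psi c * y l = y l * psi (tau l c).

(** The homogeneous part of degree [d] of the value of [f] at [y]. *)
Fixpoint skew_comp d (f : seq L -> C) : A :=
  if d is d'.+1 then \sum_(l : L) y l * skew_comp d' (fun v => f (l :: v)) else psi (f [::]).

Lemma skew_comp_filt d (f : seq L -> C) : filt d (skew_comp d f).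
Proof.
elim: d f => [|d IH] f; first exact: filt0T.
by apply: filt_sum => l _; rewrite -add1n; apply: filt_mul.
Qed.

Lemma skew_comp_lin d (a : R) (f g : seq L -> C) :
  skew_comp d (fun v => a *: f v + g v) = a *: skew_comp d f + skew_comp d g.
Proof.
elim: d f g => [|d IH] f g /=; first by rewrite linearP.
rewrite scaler_sumr -big_split; apply: eq_bigr => l _ /=.
by rewrite IH mulrDr scalerAr.
Qed.

Lemma skew_comp0 d (f : seq L -> C) : (forall w, size w = d -> f w = 0) -> skew_comp d f = 0.
Proof.
elim: d f => [|d IH] f h /=; first by rewrite h // raddf0.
by rewrite big1 // => l _; rewrite IH ?mulr0 // => w hw; rewrite h //= hw.
Qed.

Lemma skew_comp_twist d c (f : seq L -> C) :
  skew_comp d (fun v => twist tau v c * f v) = psi c * skew_comp d f.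
Proof.
elim: d c f => [|d IH] c f /=; first by rewrite rmorphM.
by rewrite mulr_sumr; apply: eq_bigr => l _; rewrite IH mulrA -psi_y mulrA.
Qed.

(** The recursion of [skew_comp] matches that of [skew_mul]; the hypothesis [psi_y] moves
    the coefficients past the values of the letters. *)
Lemma skew_comp_mul d f g :
  skew_comp d (f * g) = conv (skew_comp^~ f) (skew_comp^~ g) d.
Proof.
rewrite -[f * g]/(skew_mul tau f g : seq L -> C) /conv.
elim: d f => [|d IH] f /=; first by rewrite big_ord1 addr0 rmorphM.
rewrite big_ord_recl /= mulr_sumr.
under [X in _ = _ + X]eq_bigr do rewrite /bump leq0n add1n subSS /= mulr_suml.
rewrite exchange_big -big_split; apply: eq_bigr => l _ /=.
transitivity (y l * (psi (tau l (f [::])) * skew_comp d (fun v => g (l :: v)) +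
   skew_comp d (skew_mul tau (fun v => f (l :: v)) g))).
  congr (_ * _); rewrite -skew_comp_twist -[X in _ = X + _]scale1r -skew_comp_lin.
  by congr skew_comp; apply/funext => v; rewrite scale1r.
rewrite mulrDr mulrA -psi_y mulrA IH mulr_sumr; congr (_ + _).
by apply: eq_bigr => k _; rewrite mulrA.
Qed.

Definition skew_eval f : A := fsum (skew_comp^~ f).

Lemma null_skew_comp f : null_seq (skew_comp^~ f).
Proof. by move=> d; apply: skew_comp_filt. Qed.

Lemma skew_evalC c : skew_eval (skewC tau c) = psi c.
Proof. by rewrite /skew_eval fsum1 // => -[|d] // _; rewrite skew_comp0 // => -[]. Qed.

Lemma skew_evalX l : skew_eval (skewX l) = y l.
Proof.
rewrite /skew_eval (_ : skew_comp^~ (skewX l) = fun d => if d == 1%N then y l else 0).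
  apply: fsum_eq => -[|[|i]]; first exact: filt0T.
    by rewrite big_ord1 subr0; apply: y_filt.
  rewrite 2!big_ord_recl big1 ?addr0 //= add0r subrr; exact: filt_zero.
apply/funext => -[|[|d]].
- by rewrite /= raddf0.
- rewrite /= (bigD1 l) //= big1 ?addr0 => [|k kl].
    by rewrite /skewX eqxx rmorph1 mulr1.
  by rewrite /skewX eqseq_cons (negPf kl) raddf0 mulr0.
by rewrite skew_comp0 // => w hw; rewrite /skewX; case: eqP hw => // ->.
Qed.

(** The universal property of skew power series. *)
Lemma skew_eval_morph : exists2 phi : {lrmorphism F -> A}, phi =1 skew_eval &
  forall i f, skew_filt i f -> filt i (phi f).
Proof.
have lin : linear skew_eval.
  move=> a f g; rewrite /skew_eval fsum_lin; [|exact: null_skew_comp..].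
  by congr fsum; apply/funext => d; rewrite -skew_comp_lin.
have mul : monoid_morphism skew_eval.
  split=> [|f g]; first by rewrite -[1]/(skewC tau 1) skew_evalC rmorph1.
  rewrite /skew_eval fsumM; [|exact: null_skew_comp..].
  by congr fsum; apply/funext => d; rewrite skew_comp_mul.
pose Lm := GRing.isLinear.Build R F A *:%R skew_eval lin.
pose Mm := GRing.isMonoidMorphism.Build F A skew_eval mul.
pose phi : {lrmorphism F -> A} := HB.pack skew_eval Lm Mm.
exists phi => // i f hf; apply: fsum_filt => [|d]; first exact: null_skew_comp.
have [di|] := ltnP d i; last by move/filt_le; apply; apply: skew_comp_filt.
by rewrite skew_comp0; [apply: filt_zero | move=> w hw; apply: hf; rewrite hw].
Qed.

End SkewMorphism.

(** * The Clifford algebra *)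

Section CliffordAlgebra.
Variables (R : realType) (n : nat).
Implicit Types (i j v : mindex n).

(** The exponent of the sign in [Q^i Q^j = (-1)^beta(i, j) Q^(i + j)]. It is additive in
    both arguments, which gives the associativity of [cliff_mul]. *)
Definition beta i j : bool :=
  \sum_(k : 'I_n) \sum_(l : 'I_n | (l <= k)%N) (i k * j l : bool).

Definition dot i j : bool := \sum_(k : 'I_n) (i k * j k : bool).

Definition unit_index (k : 'I_n) : mindex n := [ffun l => l == k].

Lemma betaDl i i' j : beta (i + i') j = beta i j (+) beta i' j.
Proof.
rewrite -[RHS]/(beta i j + beta i' j).
rewrite /beta -big_split; apply: eq_bigr => k _ /=.
by rewrite -big_split; apply: eq_bigr => l _; rewrite ffunE mulrDl.
Qed.

Lemma betaDr i j j' : beta i (j + j') = beta i j (+) beta i j'.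
Proof.
rewrite -[RHS]/(beta i j + beta i j').
rewrite /beta -big_split; apply: eq_bigr => k _ /=.
by rewrite -big_split; apply: eq_bigr => l _; rewrite ffunE mulrDr.
Qed.

Lemma beta0l i : beta 0 i = 0.
Proof. by rewrite /beta big1 // => k _; rewrite big1 // => l _; rewrite ffunE mul0r. Qed.

Lemma beta0r i : beta i 0 = 0.
Proof. by rewrite /beta big1 // => k _; rewrite big1 // => l _; rewrite ffunE mulr0. Qed.

Lemma dotDr i j j' : dot i (j + j') = dot i j (+) dot i j'.
Proof.
rewrite -[RHS]/(dot i j + dot i j').
by rewrite /dot -big_split; apply: eq_bigr => l _; rewrite ffunE mulrDr. Qed.

Lemma dotC i j : dot i j = dot j i.
Proof. by apply: eq_bigr => k _; rewrite mulrC. Qed.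

Lemma dot0r i : dot i 0 = 0.
Proof. by rewrite /dot big1 // => k _; rewrite ffunE mulr0. Qed.

Lemma beta_unit (k l : 'I_n) : beta (unit_index k) (unit_index l) = (l <= k)%N.
Proof.
rewrite /beta (bigD1 k) //= [X in _ + X]big1 ?addr0 => [|m mk]; last first.
  by rewrite big1 // => ? _; rewrite ffunE (negPf mk) mul0r.
rewrite big_mkcond (bigD1 l) //= [X in _ + X]big1 ?addr0 => [|m ml]; last first.
  by rewrite !ffunE (negPf ml) mulr0 if_same.
by rewrite !ffunE !eqxx; case: ifP.
Qed.

Lemma dot_unit i (k : 'I_n) : dot i (unit_index k) = i k.
Proof.
rewrite /dot (bigD1 k) //= [X in _ + X]big1 ?addr0 => [|m mk]; last first.
  by rewrite ffunE (negPf mk) mulr0.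
by rewrite ffunE eqxx mulr1.
Qed.

(** A function [f] stands for [\sum_i f(i) Q^i]; this is the twisted group algebra
    of [{0,1}^n] with the cocycle [(-1)^beta]. *)
Definition cliff : Type := {ffun mindex n -> R}.

HB.instance Definition _ := GRing.Lmodule.copy cliff {ffun mindex n -> R}.

Implicit Types (f g h : cliff).

Definition cliff_mul f g : cliff :=
  [ffun i : mindex n => \sum_(j : mindex n) (-1) ^+ beta j (i - j) * (f j * g (i - j))].

Definition cliff_delta i : cliff := [ffun j : mindex n => (j == i)%:R].

Fact cliff_mulA : associative cliff_mul.
Proof.
move=> f g h; apply/ffunP => i; rewrite !ffunE.
transitivity (\sum_(k : mindex n) \sum_(j : mindex n) (-1) ^+ beta k (i - k) * (f k * ((-1) ^+ beta (j - k) (i - j) *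
    (g (j - k) * h (i - j))))).
  apply: eq_bigr => k _; rewrite ffunE !mulr_sumr (reindex_inj (addIr (- k))).
  by apply: eq_bigr => j _; rewrite opprB addrA subrK.
rewrite exchange_big; apply: eq_bigr => j _ /=; rewrite ffunE mulr_suml mulr_sumr.
apply: eq_bigr => k _.
have -> : beta k (i - k) = beta k (j - k) (+) beta k (i - j).
  by have := betaDr k (i - j) (j - k); rewrite subrKA => ->; apply: addbC.
have -> : beta j (i - j) = beta k (i - j) (+) beta (j - k) (i - j).
  by have := betaDl k (j - k) (i - j); rewrite addrC subrK => ->.
by rewrite !signr_addb; ring.
Qed.

Fact cliff_mul1l : left_id (cliff_delta 0) cliff_mul.
Proof.
move=> f; apply/ffunP => i; rewrite ffunE (bigD1 (0 : mindex n)) //= big1 ?addr0 => [|j j0].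
  by rewrite ffunE eqxx mul1r beta0l subr0 expr0 mul1r.
by rewrite ffunE (negPf j0) mul0r mulr0.
Qed.

Fact cliff_mul1r : right_id (cliff_delta 0) cliff_mul.
Proof.
move=> f; apply/ffunP => i; rewrite ffunE (bigD1 i) //= big1 ?addr0 => [|j j0].
  by rewrite ffunE subrr eqxx mulr1 beta0r expr0 mul1r.
by rewrite ffunE subr_eq0 eq_sym (negPf j0) !mulr0.
Qed.

Fact cliff_mulDl : left_distributive cliff_mul +%R.
Proof.
move=> f g h; apply/ffunP => i; rewrite !ffunE -big_split; apply: eq_bigr => j _ /=.
by rewrite ffunE; ring.
Qed.

Fact cliff_mulDr : right_distributive cliff_mul +%R.
Proof.
move=> f g h; apply/ffunP => i; rewrite !ffunE -big_split; apply: eq_bigr => j _ /=.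
by rewrite ffunE; ring.
Qed.

Fact cliff_1neq0 : cliff_delta 0 != 0 :> cliff.
Proof. by apply/eqP => /ffunP/(_ 0)/eqP; rewrite !ffunE eqxx oner_eq0. Qed.

HB.instance Definition _ := GRing.Zmodule_isNzRing.Build cliff
  cliff_mulA cliff_mul1l cliff_mul1r cliff_mulDl cliff_mulDr cliff_1neq0.

Lemma cliffME f g i :
  (f * g) i = \sum_(j : mindex n) (-1) ^+ beta j (i - j) * (f j * g (i - j)).
Proof. exact: ffunE. Qed.

Fact cliff_scalerAl (a : R) f g : a *: (f * g) = (a *: f) * g.
Proof.
apply/ffunP => i; rewrite !ffunE scaler_sumr; apply: eq_bigr => j _.
by rewrite ffunE /GRing.scale /=; ring.
Qed.

HB.instance Definition _ := GRing.Lmodule_isLalgebra.Build R cliff cliff_scalerAl.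

Fact cliff_scalerAr (a : R) f g : a *: (f * g) = f * (a *: g).
Proof.
apply/ffunP => i; rewrite !ffunE scaler_sumr; apply: eq_bigr => j _.
by rewrite ffunE /GRing.scale /=; ring.
Qed.

HB.instance Definition _ := GRing.Lalgebra_isAlgebra.Build R cliff cliff_scalerAr.

Lemma cliff_deltaM i j : cliff_delta i * cliff_delta j = (-1) ^+ beta i j *: cliff_delta (i + j).
Proof.
apply/ffunP => k; rewrite !ffunE (bigD1 i) //= big1 ?addr0 => [|l li]; last first.
  by rewrite ffunE (negPf li) mul0r mulr0.
rewrite !ffunE eqxx mul1r subr_eq [j + i]addrC.
by case: eqP => [->|_]; rewrite ?mulr0 ?scaler0 // [i + j]addrC addrK.
Qed.

Lemma cliff_decomp f : f = \sum_(i : mindex n) f i *: cliff_delta i.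
Proof.
apply/ffunP => k; rewrite sum_ffunE (bigD1 k) //= big1 ?addr0 => [|l lk].
  by rewrite !ffunE eqxx [RHS]mulr1.
by rewrite !ffunE eq_sym (negPf lk) scaler0.
Qed.

Fact cliff_span : exists d (e : 'I_d -> cliff),
  forall f, exists b : 'I_d -> R, f = \sum_(k < d) b k *: e k.
Proof.
exists #|{: mindex n}|, (fun k : 'I_#|{: mindex n}| => cliff_delta (enum_val k)) => f.
exists (fun k : 'I_#|{: mindex n}| => f (enum_val k)); rewrite {1}[f]cliff_decomp.
by rewrite -(big_enum_val (A := {: mindex n}) (fun i => f i *: cliff_delta i)).
Qed.

(** The automorphism [Q_k -> (-1)^(v k) Q_k]. *)
Definition cliff_twist v f : cliff := [ffun i : mindex n => (-1) ^+ dot v i * f i].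

Fact cliff_twist_linear v : linear (cliff_twist v).
Proof. by move=> a f g; apply/ffunP => i; rewrite !ffunE /GRing.scale /=; ring. Qed.

Fact cliff_twist_monoid v : monoid_morphism (cliff_twist v).
Proof.
split=> [|f g]; apply/ffunP => i; rewrite !ffunE.
  by case: eqP => [->|_]; rewrite ?dot0r ?mulr0 // expr0 mul1r.
rewrite mulr_sumr; apply: eq_bigr => j _; rewrite !ffunE.
by have := dotDr v j (i - j); rewrite addrC subrK => ->; rewrite signr_addb; ring.
Qed.

HB.instance Definition _ v := GRing.isLinear.Build R cliff cliff *:%R (cliff_twist v) (cliff_twist_linear v).
HB.instance Definition _ v := GRing.isMonoidMorphism.Build cliff cliff (cliff_twist v) (cliff_twist_monoid v).

Definition cliff_gen (k : 'I_n) : cliff := cliff_delta (unit_index k).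

Lemma cliff_gen_sqr (k : 'I_n) : cliff_gen k * cliff_gen k = -1.
Proof.
rewrite cliff_deltaM beta_unit leqnn expr1 scaleN1r; congr (- cliff_delta _).
by apply/ffunP => l; rewrite !ffunE; case: eqP.
Qed.

Lemma cliff_gen_anti (j k : 'I_n) : j != k -> cliff_gen j * cliff_gen k = - (cliff_gen k * cliff_gen j).
Proof.
move=> jk; rewrite !cliff_deltaM !beta_unit addrC -scaleNr.
by case: (ltngtP j k) => [||/val_inj/eqP]; rewrite ?(negPf jk) // !expr0 !expr1 ?opprK.
Qed.

Lemma cliff_twist_gen v (k : 'I_n) : cliff_twist v (cliff_gen k) = (-1) ^+ v k *: cliff_gen k.
Proof.
apply/ffunP => i; rewrite !ffunE.
by case: eqP => [->|_]; rewrite ?dot_unit // mulr0 scaler0.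
Qed.

(** Each [Q^i] is a common eigenvector of the twists, and the eigenvalues determine
    [i]. *)
Lemma cliff_eigen f (k : 'I_n) : (forall v, cliff_twist v f = (-1) ^+ v k *: f) ->
  f = f (unit_index k) *: cliff_gen k.
Proof.
move=> hf; apply/ffunP => i; rewrite !ffunE.
case: eqP => [->|ik]; first by rewrite [RHS]mulr1.
rewrite scaler0; have [l il] : exists l, i l != unit_index k l.
  by apply/existsP; rewrite -negb_forall; apply/forallP => h; apply: ik; apply/ffunP => l; apply/eqP.
have := congr1 (fun g : cliff => g i) (hf (unit_index l)).
have -> : (cliff_twist (unit_index l) f) i = (-1) ^+ i l * f i.
  by rewrite ffunE dotC dot_unit.
move: il; rewrite !ffunE /GRing.scale /= [k == l]eq_sym.
case: (i l); case: (l == k) => //= _; rewrite ?expr0 ?expr1 => E; lra.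
Qed.

End CliffordAlgebra.

(** * Multipowers of a Clifford system *)

Section Multipowers.
Variables (R : realType) (n : nat) (A : convAlg R) (q : {ffun 'I_n -> A}).
Hypothesis cq : clifford q.
Implicit Types (i j v : mindex n) (l : seq 'I_n) (x y : A).

Let pword l i : A := \prod_(k <- l) q k ^+ i k.

Let pword_gen l i (k : 'I_n) (b : bool) : k \notin l ->
  pword l i * q k ^+ b = (-1) ^+ ((\sum_(m <- l) (i m * b : bool))%R : bool) *: (q k ^+ b * pword l i).
Proof.
rewrite /pword; elim: l => [|m l IH]; first by rewrite !big_nil mul1r mulr1 expr0 scale1r.
rewrite !big_cons inE negb_or => /andP[km kl].
rewrite -mulrA IH // -scalerAr [X in _ *: X = _]mulrA.
have -> : q m ^+ i m * q k ^+ b = (-1) ^+ ((i m * b)%R : bool) *: (q k ^+ b * q m ^+ i m).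
  case: (i m); last by rewrite mul0r mul1r mulr1 expr0 scale1r.
  clear IH; case: b; last by rewrite mulr0 mul1r mulr1 expr0 scale1r.
  by rewrite mul1r !expr1 scaleN1r clifford_anti // eq_sym.
by rewrite -scalerAl scalerA mulrC -signr_addb [in RHS]mulrA.
Qed.

Let pwordM l i j : sorted (fun k m : 'I_n => (k < m)%N) l ->
  pword l i * pword l j =
  (-1) ^+ ((\sum_(k <- l) \sum_(m <- l | (m <= k)%N) (i k * j m : bool))%R : bool) *: pword l (i + j).
Proof.
elim: l => [|k l IH] /=; first by rewrite /pword !big_nil mul1r expr0 scale1r.
rewrite path_sortedE; last by move=> a b c; apply: ltn_trans.
case/andP=> /allP kl sl; have {IH} := IH sl; rewrite /pword !big_cons -!/(pword _ _) => IH.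
have kNl : k \notin l by apply/negP => /kl; rewrite ltnn.
rewrite leqnn [X in _ + X + _](_ : _ = 0); last first.
  by rewrite big_seq_cond big1 // => m /andP[/kl km]; rewrite leqNgt km.
rewrite -mulrA [pword l i * _]mulrA pword_gen // -scalerAl -scalerAr.
have -> : \sum_(j0 <- l) \sum_(m <- k :: l | (m <= j0)%N) (i j0 * j m : bool) =
    \sum_(m <- l) (i m * j k : bool) +
    \sum_(j0 <- l) \sum_(m <- l | (m <= j0)%N) (i j0 * j m : bool).
  rewrite -big_split [LHS]big_seq_cond [RHS]big_seq_cond /=.
  by apply: eq_bigr => m /andP[/kl km _]; rewrite big_cons ltnW.
have sq : q k ^+ i k * q k ^+ j k = (-1) ^+ ((i k * j k)%R : bool) *: q k ^+ ((i + j)%R k).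
  rewrite ffunE; case: (i k); case: (j k); rewrite ?(expr0, expr1, mul1r, mulr1, scale1r) //=.
  by rewrite clifford_sqr // scaleN1r.
rewrite -[q k ^+ j k * _ * _]mulrA IH -!scalerAr mulrA sq -scalerAl !scalerA.
by rewrite addr0 mulrC !(signr_addb, mulrA); congr (_ *: _); ring.
Qed.

Let mpowE v : mpow q v = pword (enum 'I_n) v.
Proof. by rewrite enumT /mpow [index_enum _]unlock. Qed.

(** A factor [q l] of [Q^j] passes the [q k] of [Q^i] with [k > l] on the way to its
    place, where it may meet another [q l] and give [-1]: hence the sum over [l <= k]
    in [beta]. *)
Lemma mpowM i j : mpow q i * mpow q j = (-1) ^+ beta i j *: mpow q (i + j).
Proof.
rewrite !mpowE pwordM; last first.
  have : sorted ltn (map val (enum 'I_n)) by rewrite val_enum_ord iota_ltn_sorted.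
  by rewrite sorted_map.
congr (_ ^+ _ *: _); rewrite /beta big_enum; congr nat_of_bool; apply: eq_bigr => k _.
by rewrite big_enum_cond.
Qed.

Lemma mpow0 : mpow q 0 = 1.
Proof. by rewrite /mpow big1 // => k _; rewrite ffunE expr0. Qed.

Lemma mpow_unit k : mpow q (unit_index k) = q k.
Proof.
suff E l : uniq l -> pword l (unit_index k) = if k \in l then q k else 1.
  by rewrite mpowE E ?enum_uniq // mem_enum.
rewrite /pword; elim: l => [|m l IH] /=; first by rewrite big_nil.
case/andP=> ml ul; rewrite big_cons IH // inE ffunE eq_sym.
by case: eqVneq ml => [->|_ _]; [move/negPf->; rewrite expr1 mulr1 | rewrite expr0 mul1r].
Qed.

Lemma mpow_parity i v y : (forall k, parity (v k) (q k) y) ->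
  mpow q i * y = (-1) ^+ dot v i *: (y * mpow q i).
Proof.
move=> hy.
have -> : dot v i = \sum_(k <- enum 'I_n) (v k * i k : bool) by rewrite big_enum.
rewrite !mpowE /pword; elim: (enum 'I_n) => [|k l IH].
  by rewrite !big_nil mul1r mulr1 expr0 scale1r.
rewrite !big_cons -mulrA IH -scalerAr [X in _ *: X = _]mulrA.
have -> : q k ^+ i k * y = (-1) ^+ ((v k * i k)%R : bool) *: (y * q k ^+ i k).
  case: (i k); last by rewrite mulr0 mul1r mulr1 expr0 scale1r.
  by rewrite mulr1 !expr1; apply: hy.
by rewrite -scalerAl scalerA mulrC -signr_addb [in RHS]mulrA.
Qed.

(** The universal property of the Clifford algebra. *)
Lemma cliff_morph : exists2 psi : {lrmorphism cliff R n -> A},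
  (forall c, psi c = \sum_(i : mindex n) c i *: mpow q i) & forall k, psi (cliff_gen R k) = q k.
Proof.
pose f (c : cliff R n) := \sum_(i : mindex n) c i *: mpow q i.
have fd i : f (cliff_delta R i) = mpow q i.
  rewrite /f (bigD1 i) //= big1 ?addr0 => [|j ji]; first by rewrite ffunE eqxx scale1r.
  by rewrite ffunE (negPf ji) scale0r.
have lin : linear f.
  move=> a b c; rewrite /f scaler_sumr -big_split; apply: eq_bigr => i _.
  by rewrite !ffunE scalerDl scalerA.
have mul : monoid_morphism f.
  split=> [|b c]; first by rewrite -[1]/(cliff_delta R 0) fd mpow0.
  rewrite /f mulr_suml; under [RHS]eq_bigr do rewrite mulr_sumr.
  under [LHS]eq_bigr do rewrite cliffME scaler_suml.
  rewrite exchange_big; apply: eq_bigr => j _ /=.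
  rewrite (reindex_inj (addIr j)); apply: eq_bigr => i _ /=.
  by rewrite addrK -scalerAl -scalerAr mpowM !scalerA addrC; congr (_ *: _); ring.
pose Lm := GRing.isLinear.Build R (cliff R n) A *:%R f lin.
pose Mm := GRing.isMonoidMorphism.Build (cliff R n) A f mul.
pose psi : {lrmorphism cliff R n -> A} := HB.pack f Lm Mm.
by exists psi => // k; rewrite -[LHS]/(f _) fd mpow_unit.
Qed.

End Multipowers.

(** * Products of conjugations *)

Section Conjugation.
Variables (R : realType) (n : nat) (A : convAlg R).
Implicit Types (a b q : {ffun 'I_n -> A}) (e x : A) (E : nat -> A) (d m N : nat).

Lemma tAdE e b k : filt 1 e -> tAd (aexp e) b k = aexp e * b k * aexp (- e).
Proof. by move=> he; rewrite ffunE ainv_aexp. Qed.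

Lemma tAd_cong m x b b' : tfilt m (b - b') -> tfilt m (tAd x b - tAd x b').
Proof.
move/tfiltBP => h; apply/tfiltBP => k; rewrite !ffunE -mulrBl -mulrBr.
exact/filtMr/filtMl.
Qed.

Lemma tAdK e b : filt 1 e -> tAd (aexp e) (tAd (aexp (- e)) b) = b.
Proof.
move=> he; apply/ffunP => k; rewrite !tAdE ?opprK; [|exact: filtN|by []].
by rewrite !mulrA aexp_mulN // mul1r -mulrA aexp_mulN // mulr1.
Qed.

Lemma clifford_tAd e b : filt 1 e -> clifford b -> clifford (tAd (aexp e) b).
Proof.
move=> he cb j k; rewrite !tAdE //.
have E (x y : A) : aexp e * x * aexp (- e) * (aexp e * y * aexp (- e)) =
    aexp e * (x * y) * aexp (- e).
  by rewrite !mulrA -[_ * aexp (- e) * aexp e]mulrA aexp_Nmul // mulr1.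
rewrite !E -mulrDl -mulrDr cb mulrN mulNr; congr (- _).
case: (j == k); last by rewrite mulr0 mul0r.
by rewrite mulr_natr mulrnAl aexp_mulN.
Qed.

(** Conjugation by [exp e] is [1 + [e, _]] up to terms of order 2 in [e]. *)
Lemma tAd_near d e b k : (0 < d)%N -> filt d e ->
  filt (d + d) (tAd (aexp e) b k - (b k + (e * b k - b k * e))).
Proof.
move=> d0 he; have he1 : filt 1 e by apply: filt_le he.
rewrite tAdE //.
have h1 := aexp_near d0 he.
have h2 := aexp_near d0 (filtN he).
apply: (@filt_trans _ _ _ ((1 + e) * b k * (1 - e))).
  by apply: filt_mulB => //; apply: filt_mulB => //; rewrite subrr; apply: filt_zero.
have -> : (1 + e) * b k * (1 - e) - (b k + (e * b k - b k * e)) = - (e * b k * e).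
  rewrite mulrDl mul1r mulrBr mulr1 mulrDl; apply/eqP.
  by rewrite subr_eq [X in _ == X]addrC opprD !addrA.
by apply/filtN/filt_mul => //; apply: filtMr.
Qed.

Lemma tAd_near0 d e b : (0 < d)%N -> filt d e -> tfilt d (tAd (aexp e) b - b).
Proof.
move=> d0 he; apply/tfiltBP => k.
apply: (@filt_trans _ _ _ (b k + (e * b k - b k * e))).
  by apply: filt_le (tAd_near b k d0 he); apply: leq_addr.
by rewrite addrAC subrr add0r; apply: filtB; [apply: filtMr | apply: filtMl].
Qed.

Lemma tAd_eigen (phi : {lrmorphism A -> A}) (a : R) e b k :
  (forall i x, filt i x -> filt i (phi x)) -> filt 1 e -> phi e = e ->
  phi (b k) = a *: b k -> phi (tAd (aexp e) b k) = a *: tAd (aexp e) b k.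
Proof.
move=> phif he phie phib; rewrite tAdE // !rmorphM /= phib.
rewrite !(filtered_aexp phif) ?raddfN /= ?phie //; last exact: filtN.
by rewrite -scalerAr -scalerAl.
Qed.

Definition adprod E N q := foldr (fun d b => tAd (aexp (E d)) b) q (iota 1 N).

Lemma adprodS E N q : adprod E N.+1 q = adprod E N (tAd (aexp (E N.+1)) q).
Proof. by rewrite /adprod -[in iota 1 _](addn1 N) iotaD foldr_cat add1n. Qed.

Lemma adprod_cong E N m b b' : tfilt m (b - b') -> tfilt m (adprod E N b - adprod E N b').
Proof.
by elim: N b b' => // N IH b b' h; rewrite !adprodS; apply/IH/tAd_cong.
Qed.

Lemma adprod_step E N q : (forall d, filt d (E d)) ->
  tfilt N.+1 (adprod E N.+1 q - adprod E N q).
Proof. by move=> hE; rewrite adprodS; apply/adprod_cong/tAd_near0. Qed.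

(** The limit is the sum of the differences, and this also bounds its distance to
    each term. *)
Lemma tcvg_steps (u : nat -> {ffun 'I_n -> A}) :
  (forall N, tfilt N.+1 (u N.+1 - u N)) ->
  exists2 b, tcvg u b & forall N, tfilt N.+1 (b - u N).
Proof.
move=> hu.
(* [u N] is the sum of the first [N + 1] of these differences *)
pose v k d := if d is d'.+1 then u d k - u d' k else u 0%N k.
have nv k : null_seq (v k).
  by case=> [|d]; [apply: filt0T | have /tfiltBP/(_ k) := hu d].
have sv k N : \sum_(d < N.+1) v k d = u N k.
  elim: N => [|N IH]; first by rewrite big_ord1.
  by rewrite big_ord_recr /= IH addrC subrK.
exists [ffun k => fsum (v k)] => [k i|N].
  exists i => m hm; rewrite ffunE -sv; apply: filt_le (filtBC (fsum_tail m.+1 (nv k))).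
  exact: leqW.
by apply/tfiltBP => k; rewrite ffunE -sv; apply: fsum_tail.
Qed.

Lemma tcvg_uniq (u : nat -> {ffun 'I_n -> A}) b b' : tcvg u b -> tcvg u b' -> b = b'.
Proof. by move=> h h'; apply/ffunP => k; apply: fcvg_uniq (h k) (h' k). Qed.

Lemma clifford_limit b : (forall N, exists2 c, clifford c & tfilt N (b - c)) -> clifford b.
Proof.
move=> h j k; apply: filt_eq => N; have [c cc /tfiltBP hc] := h N.
rewrite -(cc j k) opprD addrACA.
by apply: filtD; apply: filt_mulB.
Qed.

Lemma clifford_adprod E N q : (forall d, filt d (E d)) -> clifford q -> clifford (adprod E N q).
Proof.
move=> hE; elim: N q => // N IH q cq; rewrite adprodS; apply/IH/clifford_tAd => //.
exact: filt_le (hE N.+1).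
Qed.

End Conjugation.

(** * The Gram-Schmidt procedures *)

Lemma filt_prod (R : realType) (A : convAlg R) (T : Type) (s : seq T) (F : T -> A) :
  (forall x, filt 1 (F x)) -> filt (size s) (\prod_(x <- s) F x).
Proof.
move=> h; elim: s => [|x s IH]; first exact: filt0T.
by rewrite big_cons -[size _]add1n; apply: filt_mul.
Qed.

Section Procedure.
Variables (R : realType) (n : nat) (p : GS_data R n).

Section Values.
Variable A : convAlg R.
Implicit Types (a b q r : {ffun 'I_n -> A}).

Lemma GS_exponent_filt r q d : tfilt 1 r -> filt d (GS_exponent p r q d).
Proof.
move=> hr; apply: filt_sum => s _; apply: filtZ.
by rewrite -{1}(size_tuple s); apply: filt_prod => x; apply: tdiv_filt.
Qed.

Lemma GS_partialE a N :
  GS_partial p a N = adprod (GS_exponent p (a - GS a) (GS a)) N (GS a).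
Proof. by []. Qed.

Lemma GS_partial_exponent_filt a d : near_clifford a -> filt d (GS_exponent p (a - GS a) (GS a) d).
Proof. by move=> /GS_specP[_ ha _]; apply: GS_exponent_filt. Qed.

Lemma GS_procedureE a b : GS_procedure p a = Some b <->
  near_clifford a /\ tcvg (GS_partial p a) b.
Proof.
split=> [|[ha hb]]; rewrite /GS_procedure.
  by case: xgetP => [y -> [b' -> H] [<-]|].
apply: xget_unique; first by exists b.
by move=> _ [b' -> [_ hb']]; congr Some; apply: tcvg_uniq hb' hb.
Qed.

Lemma GS_procedure_ex a : near_clifford a ->
  exists2 b, GS_procedure p a = Some b & forall N, tfilt N.+1 (b - GS_partial p a N).
Proof.
move=> ha; have [N|b hb hN] := @tcvg_steps _ _ _ (GS_partial p a).
  by apply: adprod_step => d; apply: GS_partial_exponent_filt.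
by exists b => //; apply/GS_procedureE.
Qed.

Lemma GS_procedure_clifford a b : GS_procedure p a = Some b -> clifford b.
Proof.
move=> hab; have [ha _] := (GS_procedureE a b).1 hab.
have [b' + hN] := GS_procedure_ex ha; rewrite hab => -[bb']; rewrite -{}bb' in hN.
apply: clifford_limit => N; exists (GS_partial p a N).
  by apply: clifford_adprod => [d|]; [apply: GS_partial_exponent_filt | have [] := GS_specP ha].
by move=> k; apply: filt_le (hN N k).
Qed.

End Values.

Lemma GS_exponent_morph (A B : convAlg R) (f : {lrmorphism A -> B}) (r q : {ffun 'I_n -> A}) d :
  clifford q ->
  f (GS_exponent p r q d) = GS_exponent p [ffun k => f (r k)] [ffun k => f (q k)] d.
Proof.
move=> cq; rewrite raddf_sum; apply: eq_bigr => s _; rewrite /= linearZ /= rmorph_prod.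
by congr (_ *: _); apply: eq_bigr => x _; rewrite /= tdiv_morph.
Qed.

Lemma adprod_morph (A B : convAlg R) (f : {lrmorphism A -> B}) (E : nat -> A) N (q : {ffun 'I_n -> A}) :
  (forall i x, filt i x -> filt i (f x)) -> (forall d, filt d (E d)) ->
  [ffun k => f (adprod E N q k)] = adprod (f \o E) N [ffun k => f (q k)].
Proof.
move=> hf hE; elim: N q => // N IH q; rewrite !adprodS IH; congr adprod.
have hN : filt 1 (E N.+1) by apply: filt_le (hE N.+1).
apply/ffunP => k; rewrite tAdE; last exact: hf.
by rewrite !(ffunE (fun k => f (_ k))) tAdE // !rmorphM /= !(filtered_aexp hf) ?raddfN //; apply: filtN.
Qed.

Lemma GS_partial_morph (A B : convAlg R) (f : {lrmorphism A -> B}) (a : {ffun 'I_n -> A}) N :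
  (forall i x, filt i x -> filt i (f x)) -> near_clifford a ->
  GS_partial p [ffun k => f (a k)] N = [ffun k => f (GS_partial p a N k)].
Proof.
move=> hf ha; have [cq hq _] := GS_specP ha.
rewrite !GS_partialE adprod_morph // => [|d]; last exact: GS_partial_exponent_filt.
rewrite GS_morph // -morphB; congr adprod; apply/funext => d.
by rewrite /= GS_exponent_morph.
Qed.

Lemma GS_procedure_domain : FQ_domain (GS_procedure p).
Proof.
move=> A a; split=> [|ha]; last by have [b -> _] := GS_procedure_ex ha.
by case E : (GS_procedure p a) => [b|] // _; have [] := (GS_procedureE a b).1 E.
Qed.

Lemma near_clifford_dsum (A B : convAlg R) (a : {ffun 'I_n -> A}) (b : {ffun 'I_n -> B}) :
  near_clifford a -> near_clifford b ->
  near_clifford ([ffun k => (a k, b k)] : {ffun 'I_n -> dsum A B}).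
Proof.
move=> [q cq hq] [q' cq' hq'].
exists ([ffun k => (q k, q' k)] : {ffun 'I_n -> dsum A B}).
  move=> j k; rewrite !ffunE -[LHS]/(q j * q k + q k * q j, q' j * q' k + q' k * q' j).
  by rewrite cq cq'; case: (j == k).
apply/tfiltBP => k; rewrite !ffunE.
by split; [move/tfiltBP: hq => /(_ k) | move/tfiltBP: hq' => /(_ k)].
Qed.

(** Everything in the definition of the procedure commutes with morphisms: [GS] by its
    characterization, and the rest by its form. *)
Lemma GS_procedure_natural : FQ_natural (GS_procedure p).
Proof.
split=> [A B f hf a b /GS_procedureE[ha hb]|A B a b ha hb].
  apply/GS_procedureE; split; first exact: near_clifford_morph.
  move=> k; rewrite ffunE; have := filtered_fcvg hf (hb k).
  by congr fcvg; apply/funext => N; rewrite GS_partial_morph // ffunE.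
apply/GS_procedure_domain/near_clifford_dsum; exact/GS_procedure_domain.
Qed.

Lemma GS_procedure_vL : FQ_vL (GS_procedure p).
Proof.
move=> A i a b /GS_procedureE[ha hb]; have [cq _ _] := GS_specP ha.
have gs := GS_tsign i ha.
apply/GS_procedureE; split.
  exists (tsign i (GS a)); first exact: clifford_tsign.
  by have [_ h _] := GS_specP ha; rewrite -tsignB => k; rewrite ffunE; apply: filtZ.
have E N : GS_partial p (tsign i a) N = tsign i (GS_partial p a N).
  rewrite !GS_partialE gs -tsignB.
  have -> : GS_exponent p (tsign i (a - GS a)) (tsign i (GS a)) = GS_exponent p (a - GS a) (GS a).
    apply/funext => d; apply: eq_bigr => s _; congr (_ *: _); apply: eq_bigr => x _.
    exact: tdiv_tsign.
  move: (GS_exponent _ _ _) => F.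
  elim: N (GS a) => // N IH q; rewrite !adprodS -IH; congr adprod.
  by apply/ffunP => k; rewrite !ffunE -scalerAr -scalerAl.
move=> k m; have [N hN] := hb k m; exists N => M hM.
by rewrite E !(ffunE (fun k => _ *: _)) -scalerBr; apply/filtZ/hN.
Qed.

Lemma GS_procedure_vC : FQ_vC (GS_procedure p).
Proof.
move=> A q cq; have gs := GS_clifford cq.
apply/GS_procedureE; split.
  by exists q => //; apply/tfiltBP => k; rewrite subrr; apply: filt_zero.
have E N : GS_partial p q N = q.
  rewrite GS_partialE gs subrr.
  elim: N => // N IH; rewrite adprodS (_ : tAd _ _ = q) //.
  have -> : GS_exponent p (0 : {ffun 'I_n -> A}) q N.+1 = 0.
    apply: big1 => s _; rewrite (tuple_eta s) big_cons tdivE ffunE mul0r parts0 mul0r.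
    by rewrite scaler0.
  by apply/ffunP => k; rewrite tAdE ?oppr0 ?aexp0 ?mul1r ?mulr1 //; apply: filt_zero.
by move=> k m; exists 0%N => M _; rewrite E subrr; apply: filt_zero.
Qed.

End Procedure.

(** * The universal algebra *)

Section Universal.
Variables (R : realType) (n : nat).
Local Notation letter := ('I_n * mindex n)%type.

Definition letter_twist (l : letter) : {lrmorphism cliff R n -> cliff R n} := cliff_twist l.2.

(** The universal convenient algebra with a Clifford system [univQ] and elements
    [x_(j, i)] in [filt 1] whose parity with respect to [univQ k] is [i k]. *)
Definition univ : convAlg R := skewAlg letter_twist (@cliff_span R n).

Definition univQ : {ffun 'I_n -> univ} := [ffun k => skewC letter_twist (cliff_gen R k)].

Definition univX (l : letter) : univ := skewX letter_twist l.

(** The tuple [R] with [(R / Q)^i_j = x_(j, i)] for the letters [(j, i)] in [S], and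
    with the other components equal to 0 (see [tdiv_univR]). *)
Definition univR (S : pred letter) : {ffun 'I_n -> univ} :=
  [ffun k => (\sum_(i : mindex n | S (k, i)) univX (k, i)) * univQ k].

Lemma skewCM (c c' : cliff R n) :
  skewC letter_twist (c * c') = skewC letter_twist c * skewC letter_twist c'.
Proof. by apply/funext => w; rewrite skewmulCE; case: w => //= *; rewrite mul0r. Qed.

Lemma skewCN (c : cliff R n) : skewC letter_twist (- c) = - skewC letter_twist c.
Proof. by apply/funext => -[] //= *; rewrite -[RHS]/(- 0) oppr0. Qed.

Lemma univQ_clifford : clifford univQ.
Proof.
apply: cliffordI => [k|j k jk]; rewrite !ffunE.
  by rewrite -skewCM cliff_gen_sqr skewCN.
by rewrite /parity expr1 scaleN1r -!skewCM cliff_gen_anti // skewCN.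
Qed.

Lemma univX_filt l : filt 1 (univX l).
Proof. by case. Qed.

Lemma univX_parity (l : letter) k : parity (l.2 k) (univQ k) (univX l).
Proof.
rewrite /parity ffunE /univX.
have -> : skewC letter_twist (cliff_gen R k) * skewX letter_twist l =
  skewX letter_twist l * skewC letter_twist (letter_twist l (cliff_gen R k)) by apply: skewC_X.
have -> : letter_twist l (cliff_gen R k) = (-1) ^+ l.2 k *: cliff_gen R k by apply: cliff_twist_gen.
rewrite scalerAr; congr (_ * _).
by apply/funext => -[] //= *; rewrite -[RHS]/(_ *: 0) scaler0.
Qed.

Lemma univR_filt S : tfilt 1 (univR S).
Proof.
by move=> k; rewrite ffunE; apply/filtMr/filt_sum => i _; apply: univX_filt.
Qed.

Lemma tdiv_univR (S : pred letter) (i : mindex n) (j : 'I_n) :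
  tdiv (univR S) univQ i j = if S (j, i) then univX (j, i) else 0.
Proof.
have q2 k := clifford_sqr k univQ_clifford.
rewrite tdivE ffunE (ainvN1 (q2 j)) mulrN -mulrA q2 mulrN1 opprK.
rewrite parts_sum.
have E (i' : mindex n) : parts univQ i (enum 'I_n) (univX (j, i')) =
    if i == i' then univX (j, i') else 0.
  rewrite (@parts_parity _ _ _ _ _ i') //; last by move=> k _; apply: univX_parity.
  congr (if _ then _ else _); apply/allP/eqP => [h|-> k _ //].
  by apply/ffunP => k; apply/eqP/h; rewrite mem_enum.
case: ifP => [Sij|Sij]; last first.
  apply: big1 => i' Si'; rewrite E; case: eqP => // ii'; by rewrite ii' Si' in Sij.
rewrite (bigD1 i) //= E eqxx big1 ?addr0 // => i' /andP[_ ii'].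
by rewrite E eq_sym (negPf ii').
Qed.

Section Evaluation.
Variables (A : convAlg R) (q r : {ffun 'I_n -> A}).
Hypotheses (cq : clifford q) (hr : tfilt 1 r).

(** The components of [r / q] have the parities that are required of the values of the
    letters. *)
Lemma univ_eval : exists psi : {lrmorphism cliff R n -> A}, exists phi : {lrmorphism univ -> A},
  [/\ forall c, psi c = \sum_(i : mindex n) c i *: mpow q i,
      forall i x, filt i x -> filt i (phi x),
      [ffun k => phi (univQ k)] = q,
      forall l, phi (univX l) = tdiv r q l.2 l.1
    & forall f, phi f = fsum (fun d => skew_comp psi (fun l => tdiv r q l.2 l.1) d f)].
Proof.
have [psi psiE psi_gen] := cliff_morph cq.
pose y (l : letter) := tdiv r q l.2 l.1.
have yf l : filt 1 (y l) by apply: tdiv_filt.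
have py c l : psi c * y l = y l * psi (letter_twist l c).
  rewrite !psiE mulr_suml mulr_sumr; apply: eq_bigr => i _.
  rewrite ffunE -scalerAl -scalerAr mulrC -scalerA -(@mpow_parity _ _ _ _ i l.2) //.
  by move=> k; apply: tdiv_parity.
have [phi phiE phif] := skew_eval_morph yf py.
exists psi, phi; split=> //.
- by apply/ffunP => k; rewrite !ffunE phiE skew_evalC.
- by move=> l; rewrite phiE skew_evalX.
Qed.

Lemma phi_univR (S : pred letter) (phi : {lrmorphism univ -> A}) :
  (forall i j, ~~ S (j, i) -> tdiv r q i j = 0) ->
  [ffun k => phi (univQ k)] = q ->
  (forall l, phi (univX l) = tdiv r q l.2 l.1) ->
  [ffun k => phi ((univQ + univR S) k)] = q + r.
Proof.
move=> hS hq hX; apply/ffunP => k.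
have hqk : phi (univQ k) = q k by move/ffunP: hq => /(_ k); rewrite ffunE.
have E : (univQ + univR S) k =
    univQ k + (\sum_(i : mindex n | S (k, i)) univX (k, i)) * univQ k by rewrite !ffunE.
rewrite [LHS]ffunE [RHS]ffunE E raddfD /= hqk [in RHS](sum_tdiv r k cq); congr (_ + _).
rewrite rmorphM /= hqk; congr (_ * _); rewrite raddf_sum /= [RHS](bigID (fun i => S (k, i))) /=.
rewrite [X in _ = _ + X]big1 ?addr0; last by move=> i; apply: hS.
by apply: eq_bigr => i _; rewrite hX.
Qed.

End Evaluation.
End Universal.

(** * Analyticity of natural operations *)

Section Words.
Variables (R : realType) (n : nat).
Local Notation letter := ('I_n * mindex n)%type.

Definition word (A : convAlg R) (q r : {ffun 'I_n -> A}) (i : mindex n) (s : seq letter) : A :=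
  mpow q i * \prod_(x <- s) (r x.1 * mpow q x.2).

Definition expression := forall A : convAlg R, {ffun 'I_n -> A} -> {ffun 'I_n -> A} -> A.

(** Expressions that are homogeneous of degree [d] in [R], with coefficients that do
    not depend on the algebra. The monomials of [univ] become such expressions when
    they are rewritten in terms of [Q] and [R], which is what analyticity asks for. *)
Definition word_expr d (e : expression) : Prop :=
  exists c : mindex n -> seq letter -> R, forall (A : convAlg R) (q r : {ffun 'I_n -> A}), clifford q ->
    e A q r = \sum_(i : mindex n) \sum_(s : d.-tuple letter) c i s *: word q r i s.

Implicit Types (d : nat) (e : expression) (i : mindex n) (s : seq letter).

Lemma eq_word_expr d e e' : (forall (A : convAlg R) (q r : {ffun 'I_n -> A}), clifford q -> e' A q r = e A q r) ->
  word_expr d e -> word_expr d e'.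
Proof. by move=> ee [c hc]; exists c => A q r cq; rewrite ee // hc. Qed.

Lemma word_expr_lin d (a : R) e e' : word_expr d e -> word_expr d e' ->
  word_expr d (fun A q r => a *: e A q r + e' A q r).
Proof.
move=> [c hc] [c' hc']; exists (fun i s => a * c i s + c' i s) => A q r cq.
rewrite hc // hc' // scaler_sumr -big_split; apply: eq_bigr => i _.
rewrite scaler_sumr -big_split; apply: eq_bigr => s _.
by rewrite scalerDl scalerA.
Qed.

Lemma word_expr0 d : word_expr d (fun A q r => 0).
Proof.
exists (fun _ _ => 0) => A q r _; rewrite big1 // => i _.
by rewrite big1 // => s _; rewrite scale0r.
Qed.

Lemma word_exprZ d (a : R) e : word_expr d e -> word_expr d (fun A q r => a *: e A q r).
Proof.
move=> h; have := word_expr_lin a h (word_expr0 d); apply: eq_word_expr => A q r _.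
by rewrite addr0.
Qed.

Lemma word_expr_sum d (I : Type) (t : seq I) (e : I -> expression) :
  (forall k, word_expr d (e k)) -> word_expr d (fun A q r => \sum_(k <- t) e k A q r).
Proof.
move=> h; elim: t => [|k t IH].
  by apply: eq_word_expr (word_expr0 d) => A q r _; rewrite big_nil.
apply: eq_word_expr (word_expr_lin 1 (h k) IH) => A q r _.
by rewrite big_cons scale1r.
Qed.

Lemma word_expr_word d i s : size s = d -> word_expr d (fun A q r => word q r i s).
Proof.
move=> /eqP hs; exists (fun i' s' => ((i' == i) && (s' == s))%:R) => A q r _.
rewrite (bigD1 i) //= (bigD1 (Tuple hs)) //= !eqxx scale1r.
rewrite big1 => [|t ts]; last first.
  by rewrite (_ : (_ == s) = false) ?scale0r //; apply: contraNF ts => /eqP ts; apply/eqP/val_inj.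
rewrite addr0 big1 ?addr0 // => j /negPf ->.
by rewrite big1 // => t _; rewrite scale0r.
Qed.

(** Reduces a closure property under a linear operation to the words. *)
Lemma word_expr_ext d d' (op : forall A : convAlg R, {ffun 'I_n -> A} -> {ffun 'I_n -> A} -> A -> A) e :
  (forall (A : convAlg R) (q r : {ffun 'I_n -> A}), linear (op A q r)) ->
  (forall i s, size s = d -> word_expr d' (fun A q r => op A q r (word q r i s))) ->
  word_expr d e -> word_expr d' (fun A q r => op A q r (e A q r)).
Proof.
move=> lin h [c hc].
have opD (A : convAlg R) (q r : {ffun 'I_n -> A}) : {morph op A q r : x y / x + y}.
  by move=> x y; have := lin A q r 1 x y; rewrite !scale1r.
have op0 (A : convAlg R) (q r : {ffun 'I_n -> A}) : op A q r 0 = 0.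
  by have := lin A q r (-1) 0 0; rewrite scaler0 addr0 scaleN1r addNr.
have opZ (A : convAlg R) (q r : {ffun 'I_n -> A}) (a : R) x : op A q r (a *: x) = a *: op A q r x.
  by have := lin A q r a x 0; rewrite op0 !addr0.
apply: (eq_word_expr (e := fun A q r => \sum_(i : mindex n) \sum_(s : d.-tuple letter)
   c i s *: op A q r (word q r i s))).
  move=> A q r cq; rewrite hc // (big_morph _ (opD A q r) (op0 A q r)); apply: eq_bigr => i _.
  by rewrite (big_morph _ (opD A q r) (op0 A q r)); apply: eq_bigr => s _; rewrite opZ.
apply: word_expr_sum => i; apply: word_expr_sum => s.
by apply/word_exprZ/h; rewrite size_tuple.
Qed.

Lemma word_expr_mpow d i e : word_expr d e -> word_expr d (fun A q r => mpow q i * e A q r).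
Proof.
apply: (@word_expr_ext d d (fun A q r x => mpow q i * x)).
  by move=> A q r a x y; rewrite mulrDr scalerAr.
move=> j s hs; have := word_exprZ ((-1) ^+ beta i j) (word_expr_word (i + j) hs).
by apply: eq_word_expr => A q r cq; rewrite /word mulrA mpowM // scalerAl.
Qed.

Lemma word_expr_rem d (j : 'I_n) e : word_expr d e -> word_expr d.+1 (fun A q r => r j * e A q r).
Proof.
apply: (@word_expr_ext d d.+1 (fun A q r x => r j * x)).
  by move=> A q r a x y; rewrite mulrDr scalerAr.
move=> i s hs; have hs' : size ((j, i) :: s) = d.+1 by rewrite /= hs.
apply: eq_word_expr (word_expr_word 0 hs') => A q r cq.
by rewrite /word mpow0 mul1r big_cons mulrA.
Qed.

Lemma word_expr_mul d d' e e' : word_expr d e -> word_expr d' e' ->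
  word_expr (d + d') (fun A q r => e A q r * e' A q r).
Proof.
move=> he he'; move: he; apply: (@word_expr_ext d (d + d') (fun A q r x => x * e' A q r)).
  by move=> A q r a x y; rewrite mulrDl scalerAl.
move=> i s; elim: s d i => [|[j i'] s IH] [|d] i //=.
  move=> _; apply: eq_word_expr (word_expr_mpow i he') => A q r cq.
  by rewrite /word big_nil mulr1.
case=> hs; have := word_expr_mpow i (word_expr_rem j (IH d i' hs)).
by apply: eq_word_expr => A q r cq; rewrite /word big_cons /= !mulrA.
Qed.

Lemma word_expr_gen (k : 'I_n) : word_expr 0 (fun A q r => q k).
Proof.
apply: eq_word_expr (@word_expr_word 0 (unit_index k) [::] erefl) => A q r cq.
by rewrite /word big_nil mulr1 mpow_unit.
Qed.

Lemma word_expr_parts d (i : 'I_n -> bool) (l : seq 'I_n) e : word_expr d e ->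
  word_expr d (fun A q r => parts q i l (e A q r)).
Proof.
elim: l e => //= k l IH e he; apply: (IH (fun A q r => part (i k) (q k) (e A q r))).
have h := word_expr_mul (word_expr_mul (word_expr_gen k) he) (word_expr_gen k).
rewrite add0n addn0 in h.
have := word_exprZ 2^-1 (word_expr_lin (- (-1) ^+ i k) h he).
apply: eq_word_expr => A q r cq; rewrite partE; last exact: clifford_sqr.
by rewrite scaleNr addrC.
Qed.

Lemma word_expr_tdiv (i : mindex n) (j : 'I_n) : word_expr 1 (fun A q r => tdiv r q i j).
Proof.
apply: word_expr_parts.
apply: eq_word_expr (word_exprZ (-1) (word_expr_rem j (word_expr_gen j))) => A q r cq.
by rewrite ainvN1 ?mulrN ?scaleN1r //; apply: clifford_sqr.
Qed.

Lemma word_expr_comp d (f : seq letter -> cliff R n) :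
  exists c : mindex n -> seq letter -> R,
  forall (A : convAlg R) (q r : {ffun 'I_n -> A}) (psi : {lrmorphism cliff R n -> A}), clifford q ->
    (forall x, psi x = \sum_(i : mindex n) x i *: mpow q i) ->
    skew_comp psi (fun l => tdiv r q l.2 l.1) d f =
    \sum_(i : mindex n) \sum_(s : d.-tuple letter) c i s *: word q r i s.
Proof.
pose comp := fix comp d (f : seq letter -> cliff R n) : expression := fun A q r =>
  if d is d'.+1 then \sum_(l : letter) tdiv r q l.2 l.1 * comp d' (fun v => f (l :: v)) A q r
  else \sum_(i : mindex n) f [::] i *: mpow q i.
have compE (A : convAlg R) (q r : {ffun 'I_n -> A}) (psi : {lrmorphism cliff R n -> A}) m g :
    (forall x, psi x = \sum_(i : mindex n) x i *: mpow q i) ->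
    skew_comp psi (fun l => tdiv r q l.2 l.1) m g = comp m g A q r.
  move=> psiE; elim: m g => [|m IH] g /=; first exact: psiE.
  by apply: eq_bigr => l _; rewrite IH.
have : word_expr d (comp d f).
  elim: d f => [|d IH] f /=.
    apply: word_expr_sum => i; apply: word_exprZ.
    apply: eq_word_expr (@word_expr_word 0 i [::] erefl) => A q r cq.
    by rewrite /word big_nil mulr1.
  apply: word_expr_sum => l; rewrite -add1n.
  exact: word_expr_mul (word_expr_tdiv _ _) (IH _).
move=> [c hc]; exists c => A q r psi cq psiE.
by rewrite compE // hc.
Qed.

Lemma near_clifford_add (A : convAlg R) (q r : {ffun 'I_n -> A}) :
  clifford q -> tfilt 1 r -> near_clifford (q + r).
Proof. by move=> cq hr; exists q => //; rewrite addrAC subrr add0r. Qed.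

(** The tuple [Q + R] is the image of the universal one, so its value is the image of
    the universal value; the coefficients are those of that one series. *)
Lemma natural_analytic (Psi : FQop R n) : FQ_domain Psi -> FQ_natural Psi -> FQ_analytic Psi.
Proof.
move=> dom [natP _].
pose a := univQ R n + univR R (fun=> true).
have na : near_clifford a by apply: near_clifford_add; [apply: univQ_clifford | apply: univR_filt].
have := (dom _ a).2 na; case Eb : (Psi _ a) => [b|] // _.
have [c hc] := choice (fun kd : 'I_n * nat => word_expr_comp kd.2 (b kd.1)).
exists (fun k i s => c (k, size s) i s) => A q r cq hr.
have [psi [phi [psiE phif phiQ phiX phiE]]] := univ_eval cq hr.
have phia : [ffun k => phi (a k)] = q + r by apply: phi_univR.
exists [ffun k => phi (b k)]; first by rewrite -phia; apply: natP Eb.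
move=> k; rewrite ffunE phiE.
have nullc : null_seq (fun d => skew_comp psi (fun l => tdiv r q l.2 l.1) d (b k)).
  by apply: null_skew_comp => l; apply: tdiv_filt.
have := fsum_cvg nullc; congr fcvg; apply/funext => N; apply: eq_bigr => d _.
rewrite (hc (k, nat_of_ord d) A q r psi cq psiE); apply: eq_bigr => i _; apply: eq_bigr => s _.
by rewrite size_tuple.
Qed.

End Words.

(** * The universal tuple *)

Section DiagonalEndomorphisms.
Variables (R : realType) (C : algType R) (L : finType) (tau : L -> {lrmorphism C -> C}).
Variables (t : L -> R) (theta : {lrmorphism C -> C}).
Hypothesis theta_tau : forall l c, theta (tau l c) = tau l (theta c).
Local Notation F := (skew tau).

(** Rescales the letter [x_l] by [t l] and acts on the coefficients by [theta]. *)
Definition skew_diag (f : seq L -> C) : F := fun w => (\prod_(l <- w) t l) *: theta (f w).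

Lemma skew_diag_morph : exists2 phi : {lrmorphism F -> F}, phi =1 skew_diag &
  forall i f, skew_filt i f -> skew_filt i (phi f).
Proof.
have thw w c : theta (twist tau w c) = twist tau w (theta c).
  by elim: w c => //= l w IH c; rewrite IH theta_tau.
have lin : linear (skew_diag : F -> F).
  move=> a f g; apply/funext => w; rewrite /skew_diag linearP scalerDr !scalerA mulrC -scalerA.
  by [].
have mulw (f g : F) w : skew_diag (skew_mul tau f g) w = skew_mul tau (skew_diag f) (skew_diag g) w.
  elim: w f => [|l w IH] f; rewrite /skew_diag /= !big_nil scale1r.
    by rewrite !addr0 rmorphM !scale1r.
  rewrite raddfD /= rmorphM /= scalerDr thw theta_tau -scalerAr; congr (_ + _).
  rewrite big_cons -scalerA -[X in _ *: X]/(skew_diag (skew_mul tau (fun v => f (l :: v)) g) w) IH.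
  have := skew_mul_linl tau (t l) (skew_diag (fun v => f (l :: v))) (fun=> 0) (skew_diag g) w.
  rewrite skew_mul0l addr0 => <-; congr skew_mul; apply/funext => v.
  by rewrite addr0 /skew_diag big_cons scalerA.
have mul : monoid_morphism (skew_diag : F -> F).
  split=> [|f g]; apply/funext => w; last exact: mulw.
  rewrite -[LHS]/(skew_diag (skewC tau 1) w) -[RHS]/(skewC tau 1 w) /skew_diag.
  by case: w => [|l w] /=; rewrite ?big_nil ?scale1r ?rmorph1 // raddf0 scaler0.
pose Lm := GRing.isLinear.Build R F F *:%R skew_diag lin.
pose Mm := GRing.isMonoidMorphism.Build F F skew_diag mul.
pose phi : {lrmorphism F -> F} := HB.pack (skew_diag : F -> F) Lm Mm.
by exists phi => // i f hf w hw; rewrite -[LHS]/(skew_diag f w) /skew_diag hf // raddf0 scaler0.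
Qed.

End DiagonalEndomorphisms.

Section UniversalTuple.
Variables (R : realType) (n : nat).
Local Notation letter := ('I_n * mindex n)%type.
Local Notation U := (univ R n).
Local Notation Q := (univQ R n).
Implicit Types (w s : seq letter) (k : 'I_n) (v : mindex n).

Definition nonfirst (l : letter) : bool := ~~ is_first l.1 l.2.

(** The tuple with remainder [R] such that [(R / Q)^i_j] is free except when [j] is the
    first index of [i], where it vanishes. These are exactly the constraints on the
    remainder of a Gram-Schmidt system, so that [Q] is the system of [univA]. *)
Definition univA : {ffun 'I_n -> U} := Q + univR R nonfirst.

(** The terms of the residue that survive the projections have [i] vanishing below [k];
    as [(k, i)] is not first, [i k] vanishes too, and the term commutes with [Q k]. *)
Lemma univA_spec : GS_spec univA Q.
Proof.
split; first exact: univQ_clifford.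
  by rewrite /univA addrAC subrr add0r; apply: univR_filt.
move=> k; have cq := @univQ_clifford R n.
rewrite /GS_residue (_ : univA k = Q k + (\sum_(i : mindex n | nonfirst (k, i)) univX R (k, i)) * Q k);
  last by rewrite !ffunE.
rewrite partsD -[parts Q _ _ (Q k)]/(GS_residue Q Q k) GS_residue_self //.
rewrite parts_mulr // ?mem_take_enum ?ltnn // -[X in X + _]mul1r -mulrDl.
suff E : parity false (Q k) (1 + parts Q (fun=> false) (take k (enum 'I_n))
    (\sum_(i : mindex n | nonfirst (k, i)) univX R (k, i))).
  by move: E; rewrite /parity !expr0 !scale1r mulrA => ->.
rewrite /parity expr0 scale1r mulrDr mulrDl mulr1 mul1r; congr (_ + _).
rewrite parts_sum mulr_sumr mulr_suml; apply: eq_bigr => i nf.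
have q2 j := clifford_sqr j cq.
rewrite (@parts_parity _ _ _ _ _ i) //; last by move=> j _; apply: univX_parity.
case: ifP => [/allP h|_]; last by rewrite mul0r mulr0.
have ik : i k = false.
  apply: contraNF nf => ik; rewrite /nonfirst /is_first ik /=; apply/forallP => j.
  apply/implyP => ij; rewrite leqNgt; apply/negP => jk.
  by have := h j; rewrite mem_take_enum jk ij => /(_ isT).
by have := univX_parity R (k, i) k; rewrite /parity ik expr0 scale1r.
Qed.

Lemma univA_near : near_clifford univA.
Proof. exact: GS_spec_near univA_spec. Qed.

(** The morphism maps [Q] to [GS a] and the letters to the components of the remainder;
    those with first indices vanish by [tdiv_first], and the others add up to it. *)
Lemma univA_universal (A : convAlg R) (a : {ffun 'I_n -> A}) : near_clifford a ->
  exists2 phi : {lrmorphism U -> A}, (forall i x, filt i x -> filt i (phi x)) &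
  [ffun k => phi (univA k)] = a.
Proof.
move=> /GS_specP sp; have [cq hr _] := sp.
have [psi [phi [_ phif phiQ phiX _]]] := univ_eval cq hr.
exists phi => //; rewrite [RHS](_ : a = GS a + (a - GS a)); last by rewrite addrC subrK.
apply: phi_univR => // i j; rewrite negbK => ij; exact: tdiv_first.
Qed.

Lemma FQ_ext (Psi Psi' : FQop R n) : FQ_domain Psi -> FQ_natural Psi ->
  FQ_domain Psi' -> FQ_natural Psi' -> Psi U univA = Psi' U univA -> Psi = Psi'.
Proof.
move=> dom [nt _] dom' [nt' _] E; apply: functional_extensionality_dep => A.
apply/funext => a; case: (pselect (near_clifford a)) => [ha|ha].
  have [phi phif <-] := univA_universal ha.
  have := (dom U univA).2 univA_near; case Eb : (Psi U univA) => [b|] // _.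
  by rewrite (nt _ _ phi phif _ _ Eb) (nt' _ _ phi phif univA b) // -E.
case E1 : (Psi A a) => [b|]; first by case: ha; apply/dom; rewrite E1.
case E2 : (Psi' A a) => [b|] //; by case: ha; apply/dom'; rewrite E2.
Qed.

(** The endomorphism [x_l -> t(l) x_l], [Q_k -> (-1)^(v k) Q_k] of [univ]. It is
    specified rather than defined, as [skew_diag_morph] gives only its existence. *)
Definition diag (t : letter -> R) v : {lrmorphism U -> U} -> Prop := fun phi =>
  (forall i x, filt i x -> filt i (phi x)) /\
  forall (f : U) w, phi f w = (\prod_(l <- w) t l) *: cliff_twist v (f w).

Lemma diag_ex t v : exists phi, diag t v phi.
Proof.
have [l c|phi h1 h2] := @skew_diag_morph R (cliff R n) _ (@letter_twist R n) t (cliff_twist v).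
  by apply/ffunP => i; rewrite !ffunE mulrCA.
by exists phi; split=> // f w; rewrite h1.
Qed.

End UniversalTuple.

(** * The leading part of an orthogonalization *)

Section DegreeStep.
Variables (R : realType) (n : nat).
Local Notation letter := ('I_n * mindex n)%type.
Local Notation U := (univ R n).
Local Notation Q := (univQ R n).
Local Notation gen := (@cliff_gen R n).
Implicit Types (w s : seq letter) (k j : 'I_n) (v : mindex n) (b : {ffun 'I_n -> U}) (d m : nat)
  (c : seq letter -> R) (f g : U).

Definition weight w : mindex n := [ffun h => \big[addb/false]_(x <- w) x.2 h].

Lemma twist_gen w k : twist (@letter_twist R n) w (gen k) = (-1) ^+ weight w k *: gen k.
Proof.
rewrite ffunE; elim: w => [|l w IH] /=; first by rewrite big_nil expr0 scale1r.
have -> : letter_twist R l (gen k) = (-1) ^+ l.2 k *: gen k by apply: cliff_twist_gen.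
have := twist_lin (@letter_twist R n) w ((-1) ^+ l.2 k) (gen k) 0.
rewrite twist0 !addr0 => ->; rewrite IH scalerA.
by rewrite big_cons signr_addb.
Qed.

Lemma univQ_mulE k f w : (Q k * f) w = (-1) ^+ weight w k *: (gen k * f w).
Proof.
rewrite ffunE -[LHS]/(skew_mul (@letter_twist R n) (skewC _ (gen k)) f w) skew_mulCl twist_gen.
by rewrite scalerAl.
Qed.

Lemma univ_mulQE f k w : (f * Q k) w = f w * gen k.
Proof. by rewrite ffunE; apply: skewmulCE. Qed.

Lemma univQ_cons k l w : Q k (l :: w) = 0.
Proof. by rewrite ffunE. Qed.

(** The exponent of degree [d] with coefficients [c] (see [GS_exponent_univ]). *)
Definition univE c d : U := fun w => if (size w == d) && GS_index w then (c w)%:A else 0.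

Lemma univE_filt c d : filt d (univE c d).
Proof. by move=> w hw; rewrite /univE ltn_eqF. Qed.

(** As [x_w] commutes with [Q k] up to the sign [(-1)^(weight w k)], only the words with
    [weight w k] contribute, with a factor 2. *)
Lemma univE_comm c d k w :
  (univE c d * Q k - Q k * univE c d) w =
  (if (size w == d) && GS_index w then (1 - (-1) ^+ weight w k) * c w else 0) *: gen k.
Proof.
rewrite skewBE univQ_mulE univ_mulQE /univE; case: ifP => _; last first.
  by rewrite mul0r mulr0 scaler0 subrr scale0r.
by rewrite -scalerAl -scalerAr mul1r mulr1 scalerA mulrBl mul1r scalerBl.
Qed.

Lemma prod_univX s w : (\prod_(x <- s) univX R x) w = if w == s then 1 else 0.
Proof.
elim: s w => [|l s IH] w; first by rewrite big_nil; case: w.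
rewrite big_cons -[LHS]/((skewX _ l * _) w) skewX_mulE; case: w => [|x w] //.
by rewrite eqseq_cons; case: eqP => //= _; rewrite IH.
Qed.

Lemma GS_exponent_univ (p : GS_data R n) d :
  GS_exponent p (univR R (@nonfirst n)) Q d = univE (GS_coef p) d.
Proof.
apply/funext => w; rewrite /GS_exponent skew_sumE /univE.
have E (s : d.-tuple letter) : GS_index s ->
    (GS_coef p s *: \prod_(x <- s) tdiv (univR R (@nonfirst n)) Q x.2 x.1) w =
    if w == s then (GS_coef p s)%:A else 0.
  move=> /and3P[_ /allP hs _]; rewrite (_ : \prod_(x <- s) _ = \prod_(x <- s) univX R x).
    by rewrite skewZE prod_univX; case: ifP => // _; rewrite scaler0.
  by apply: eq_big_seq => -[j i] /hs nf; rewrite tdiv_univR /nonfirst nf.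
rewrite (eq_bigr _ E); case: eqP => [hw|hw] /=; last first.
  by apply: big1 => s _; case: eqP => // ws; case: hw; rewrite ws size_tuple.
have {hw}hw : size w == d by apply/eqP.
case: ifP => ws.
  rewrite (bigD1 (Tuple hw)) //= eqxx big1 ?addr0 // => s /andP[_ sw].
  by case: eqP => // E'; case/eqP: sw; apply: val_inj.
apply: big1 => s hs; case: eqP => // E'; by rewrite E' hs in ws.
Qed.

(** Equivalent to equivariance under the endomorphisms of [invariantP], which is how
    the property is obtained and preserved. It means that [b k] is the product of a
    series in the [x_l], [l] not first, with [Q k]. *)
Definition invariant b := forall k v w,
  cliff_twist v (b k w) = (-1) ^+ v k *: b k w /\
  (~~ all (@nonfirst n) w -> b k w = 0).

Lemma cliff_twist0 (x : cliff R n) : cliff_twist 0 x = x.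
Proof. by apply/ffunP => i; rewrite ffunE dotC dot0r expr0 mul1r. Qed.

Lemma prod_nonfirst w : \prod_(l <- w) (nonfirst l)%:R = (all (@nonfirst n) w)%:R :> R.
Proof.
elim: w => [|l w IH]; first by rewrite big_nil.
by rewrite big_cons IH /=; case: nonfirst; rewrite ?mul1r ?mul0r.
Qed.

Lemma invariantP b : invariant b <->
  (forall v phi, diag (fun=> 1) v phi -> forall k, phi (b k) = (-1) ^+ v k *: b k) /\
  (forall phi, diag (fun l => (nonfirst l)%:R) 0 phi -> forall k, phi (b k) = b k).
Proof.
split=> [inv|[h1 h2] j v w].
  split=> [v phi [_ hphi] j|phi [_ hphi] j]; apply/funext => w; rewrite hphi.
    by rewrite big1_eq scale1r; have [-> _] := inv j v w.
  rewrite cliff_twist0 prod_nonfirst; have [_ h] := inv j 0 w.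
  by case hw : (all _ w); rewrite ?scale1r // h ?scaler0 ?hw.
have [phi hphi] := diag_ex (fun=> 1 : R) v.
have [psi hpsi] := diag_ex (fun l => (nonfirst l)%:R : R) (0 : mindex n).
split.
  have := congr1 (fun f : U => f w) (h1 v phi hphi j); case: hphi => _ ->.
  by rewrite big1_eq scale1r.
move=> /negPf h; have := congr1 (fun f : U => f w) (h2 psi hpsi j); case: hpsi => _ ->.
by rewrite prod_nonfirst h scale0r.
Qed.

Lemma invariant_tAd c d b : (0 < d)%N -> invariant b ->
  invariant (tAd (aexp (- univE c d)) b).
Proof.
move=> d0 /invariantP[h1 h2].
have hE : filt 1 (- univE c d) by apply: filtN; exact: (@filt_le _ U 1 d _ d0 (@univE_filt c d)).
have phiN (phi : {lrmorphism U -> U}) : phi (univE c d) = univE c d ->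
    phi (- univE c d) = - univE c d by move=> E; rewrite raddfN /= E.
apply/invariantP; split=> [v phi hphi k|phi hphi k].
  apply: (tAd_eigen _ hE _ (h1 v phi hphi k)); [by case: hphi | apply: phiN].
  apply/funext => w; case: hphi => _ ->; rewrite big1_eq scale1r /univE.
  by case: ifP => _; [rewrite linearZ /= rmorph1 | rewrite raddf0].
rewrite -[RHS]scale1r.
apply: (tAd_eigen _ hE); [by case: hphi | apply: phiN | by rewrite scale1r h2].
apply/funext => w; case: hphi => _ ->; rewrite cliff_twist0 prod_nonfirst /univE.
case: ifP => [/and4P[_ _ nf _]|_]; last by rewrite scaler0.
by rewrite (_ : all _ _) // scale1r.
Qed.

(** If [b] agrees with [Q] below the degree of [w], this is the coefficient of [x_w] in
    an exponent whose commutator with [Q] is the next term of [b - Q]. By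
    [leading_comm] all [h] with [weight w h] give the same value. *)
Definition leading b w : R :=
  if [pick h | weight w h] is Some h then 2^-1 * (b h w) (unit_index h) else 0.

(** Let [beta k] be the coefficient of [x_w Q_k] in [b k]. Up to terms of degree [2 d],
    the Clifford relations for [b] are linear in [b - Q], and at [w] they say that
    [beta k] vanishes unless [weight w k], and that [beta k = beta h] if also [weight w h].
    So one number gives all the [beta k], as in the commutator of [x_w] with [Q]. *)
Lemma leading_comm b d k w : clifford b -> invariant b -> (0 < d)%N -> tfilt d (b - Q) ->
  size w = d ->
  (b k - Q k) w = (univE (leading b) d * Q k - Q k * univE (leading b) d) w.
Proof.
move=> cb inv d0 /tfiltBP hb sw.
(* at a nonempty word the series [Q k] vanishes *)
case: w sw => [|l w'] sw; first by rewrite -sw in d0.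
set w := l :: w' in sw *.
pose beta k := (b k w) (unit_index k).
have bE j : b j w = beta j *: gen j by apply: cliff_eigen => v; have [] := inv j v w.
have dE j : (b j - Q j) w = beta j *: gen j.
  by rewrite skewBE univQ_cons subr0 bE.
rewrite dE univE_comm sw eqxx /=; congr (_ *: _).
pose sg j : R := (-1) ^+ weight w j.
(* the Clifford relation of [b i] and [b j], at the word [w] *)
have rel i j : (sg i * beta j + beta i) *: (gen i * gen j) +
    (sg j * beta i + beta j) *: (gen j * gen i) = 0.
  have bb (i' j' : 'I_n) : (b i' * b j') w =
      (Q i' * Q j') w + (sg i' * beta j' + beta i') *: (gen i' * gen j').
    have -> : b i' * b j' = Q i' * Q j' + (Q i' * (b j' - Q j') + (b i' - Q i') * Q j' +
        (b i' - Q i') * (b j' - Q j')).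
      rewrite -[Q i' * _ + _ + _]addrA -[(_ - _) * Q j' + _]mulrDr [Q j' + _]addrC subrK.
      by rewrite addrA -mulrDr [Q j' + _]addrC subrK -mulrDl [Q i' + _]addrC subrK.
    have dd : ((b i' - Q i') * (b j' - Q j')) w = 0.
      have := @filt_mul _ U d d _ _ (hb i') (hb j'); apply.
      by rewrite sw -[X in (X < _)%N]addn0 ltn_add2l.
    rewrite 3!skewDE dd (univQ_mulE i' (b j' - Q j')) (univ_mulQE (b i' - Q i')) !dE addr0; congr (_ + _).
    by rewrite -scalerAr -scalerAl scalerA -scalerDl.
  have := cb i j; rewrite -(@univQ_clifford R n i j) => /(congr1 (fun f : U => f w)).
  by rewrite !skewDE !bb addrACA => E; apply: (addrI _); rewrite addr0; exact: E.
have e1 j : sg j * beta j + beta j = 0.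
  have := rel j j; rewrite -scalerDl cliff_gen_sqr => /eqP.
  rewrite scaler_eq0 oppr_eq0 oner_eq0 orbF => /eqP; lra.
have e2 i j : i != j -> sg i * beta j + beta i = sg j * beta i + beta j.
  move=> ij; have := rel i j; rewrite [gen j * _]cliff_gen_anti 1?eq_sym // scalerN -scalerBl => /eqP.
  rewrite scaler_eq0 subr_eq0 => /orP[/eqP //|/eqP g0].
  have /eqP : gen i * gen j * (gen j * gen i) = 0 by rewrite g0 mul0r.
  rewrite mulrA -[_ * gen j * gen j]mulrA cliff_gen_sqr mulrN1 mulNr cliff_gen_sqr opprK.
  by rewrite oner_eq0.
rewrite -/(sg k); case wk : (weight w k); last first.
  have := e1 k; rewrite {1 2}/sg wk expr0 => h.
  by case: ifP => _; lra.
have sk : sg k = -1 by rewrite /sg wk expr1.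
rewrite sk /leading; case: pickP => [h wh|/(_ k)]; last by rewrite wk.
have sh : sg h = -1 by rewrite /sg wh expr1.
have bkh : beta k = beta h.
  by case: (eqVneq k h) => [-> //|/e2]; rewrite sk sh; lra.
case: ifP => [_|gs]; first by rewrite -/(beta h) bkh; lra.
suff : b k w = 0 by rewrite /beta => ->; rewrite ffunE.
have [_ -> //] := inv k 0 w; apply: contraFN gs => nf.
apply/and3P; split=> //; apply/existsP; exists k.
by rewrite ffunE in wk.
Qed.

End DegreeStep.

(** * Exponents and values *)

Lemma commutator_shift (T : pzRingType) (e x q : T) :
  x + (- e * x - x * - e) - q =
  (x - q) - (e * q - q * e) - (e * (x - q) - (x - q) * e).
Proof.
have E : e * x - x * e = (e * q - q * e) + (e * (x - q) - (x - q) * e).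
  by rewrite addrACA -opprD -mulrDr -mulrDl ![q + _]addrC !subrK.
rewrite -[RHS]addrA -opprD -E mulrN mulNr opprK opprB addrAC.
by congr (_ + _); rewrite addrC.
Qed.

Section ConjugationCongruences.
Variables (R : realType) (n : nat) (A : convAlg R).
Implicit Types (a b q : {ffun 'I_n -> A}) (e : A) (E : nat -> A) (d m N : nat).

(** Conjugation by [exp (- e)] subtracts the commutator with [e] from [b], so that it
    removes the term of degree [d] of [b - q] if that term is this commutator. *)
Lemma tAd_correct d e b q k : (0 < d)%N -> filt d e -> filt d (b k - q k) ->
  filt d.+1 ((b k - q k) - (e * q k - q k * e)) ->
  filt d.+1 (tAd (aexp (- e)) b k - q k).
Proof.
move=> d0 he hb h; have d1 : (d.+1 <= d + d)%N by rewrite -addn1 leq_add2l.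
apply: (filt_trans (filt_le d1 (tAd_near b k d0 (filtN he)))).
rewrite commutator_shift; apply: filtB => //.
by apply: filtB; apply: (filt_le d1); apply: filt_mul.
Qed.

Lemma tAd_commutators d e e' q k : (0 < d)%N -> filt d e -> filt d e' ->
  filt d.+1 (tAd (aexp e) q k - tAd (aexp e') q k) ->
  filt d.+1 ((e * q k - q k * e) - (e' * q k - q k * e')).
Proof.
move=> d0 he he' h; have d1 : (d.+1 <= d + d)%N by rewrite -addn1 leq_add2l.
have n1 := filt_le d1 (tAd_near q k d0 he).
have n2 := filt_le d1 (tAd_near q k d0 he').
have := filt_trans (filtBC n1) (filt_trans h n2).
by rewrite opprD addrACA subrr add0r.
Qed.

Lemma adprod_inj E N m b b' : (forall d, filt d (E d)) ->
  tfilt m (adprod E N b - adprod E N b') -> tfilt m (b - b').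
Proof.
move=> hE; elim: N b b' => // N IH b b'; rewrite !adprodS => /IH h.
have hN : filt 1 (E N.+1) by apply: filt_le (hE N.+1).
have := tAd_cong (aexp (- E N.+1)) h.
have K x : tAd (aexp (- E N.+1)) (tAd (aexp (E N.+1)) x) = x.
  by rewrite -{2}[E N.+1]opprK tAdK //; apply: filtN.
by rewrite !K.
Qed.

Lemma adprod_eq E E' N q : (forall d, (0 < d <= N)%N -> E d = E' d) ->
  adprod E N q = adprod E' N q.
Proof.
elim: N q => // N IH q h; rewrite !adprodS IH ?h ?leqnn // => d /andP[d0 dN].
by apply: h; rewrite d0 ltnW.
Qed.

Lemma adprod_telescope E (B : nat -> {ffun 'I_n -> A}) N : (forall d, filt d (E d)) ->
  (forall m, B m.+1 = tAd (aexp (- E m.+1)) (B m)) -> adprod E N (B N) = B 0%N.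
Proof.
move=> hE hB; elim: N => // N IH; rewrite adprodS hB tAdK //.
exact: filt_le (hE N.+1).
Qed.

Lemma GS_partial_spec (p : GS_data R n) a q N : GS_spec a q ->
  GS_partial p a N = adprod (GS_exponent p (a - q) q) N q.
Proof. by move/GS_spec_unique=> <-. Qed.

Lemma add_subl b q : q + b - q = b.
Proof. by rewrite addrAC subrr add0r. Qed.

Lemma tfilt_tcvg (u : nat -> {ffun 'I_n -> A}) b : (forall N, tfilt N.+1 (b - u N)) -> tcvg u b.
Proof.
move=> h k i; exists i => N iN; apply: filtBC; have /tfiltBP/(_ k) := h N.
by apply: filt_le; apply: leqW.
Qed.

Lemma tfilt_trans m b b' q : tfilt m (q - b) -> tfilt m (q - b') -> tfilt m (b - b').
Proof.
move=> /tfiltBP h /tfiltBP h'; apply/tfiltBP => k.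
exact: filt_trans (filtBC (h k)) (h' k).
Qed.

End ConjugationCongruences.

Section Bijection.
Variables (R : realType) (n : nat).
Local Notation letter := ('I_n * mindex n)%type.
Local Notation U := (univ R n).
Local Notation Q := (univQ R n).
Local Notation A := (univA R n).
Implicit Types (w s : seq letter) (k j : 'I_n) (v : mindex n) (b : {ffun 'I_n -> U}) (d m N : nat)
  (c : seq letter -> R) (p : GS_data R n).

Lemma degree_step b d : clifford b -> invariant b -> (0 < d)%N -> tfilt d (b - Q) ->
  let b' := tAd (aexp (- univE (leading b) d)) b in
  [/\ clifford b', invariant b' & tfilt d.+1 (b' - Q)].
Proof.
move=> cb inv d0 hb b'; have hE := @univE_filt R n (leading b) d : filt d (univE (leading b) d : U).
split; [|exact: invariant_tAd|].
  by apply: clifford_tAd cb; apply: filtN; apply: (filt_le d0 hE).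
apply/tfiltBP => k; have /tfiltBP/(_ k) hk := hb.
apply: (tAd_correct d0 hE hk).
move=> w; rewrite ltnS leq_eqVlt => /predU1P[sw|sw]; rewrite skewBE.
  by rewrite (leading_comm k cb inv d0 hb sw) subrr.
have hc : filt d (univE (leading b) d * Q k - Q k * univE (leading b) d).
  by apply: filtB; [apply: filtMr | apply: filtMl].
by rewrite (hk w sw) (hc w sw) subrr.
Qed.

Lemma GS_partial_univ p N :
  GS_partial p A N = adprod (univE (GS_coef p)) N Q.
Proof.
have E0 : A - Q = univR R (@nonfirst n) by apply: add_subl.
have E : GS_exponent p (A - Q) Q = univE (GS_coef p).
  apply/funext => d; apply: (etrans _ (GS_exponent_univ p d)).
  exact: (congr1 (fun r : {ffun 'I_n -> U} => GS_exponent p r Q d) E0).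
apply: (etrans (GS_partial_spec p N (univA_spec R n))).
exact: (congr1 (fun e : nat -> U => adprod e N Q) E).
Qed.

Lemma univE_eq c c' d : (forall s, size s = d -> GS_index s -> c s = c' s) ->
  univE c d = univE c' d.
Proof.
move=> h; apply/funext => w; rewrite /univE.
by case: ifP => // /andP[/eqP sw gs]; rewrite h.
Qed.

(** The leading parts are split off one degree after the other: [B m] is [b] with the
    first [m] factors removed, and its leading part gives the coefficients of the next
    exponent. As [B N] tends to [Q], the partial products tend to [b]. *)
Lemma GS_procedure_surj b : clifford b -> invariant b -> tfilt 1 (b - Q) ->
  exists p, GS_procedure p A = Some b.
Proof.
move=> cb inv hb.
pose B := fix B m := if m is m'.+1 then tAd (aexp (- univE (leading (B m')) m)) (B m') else b.
have HB m : [/\ clifford (B m), invariant (B m) & tfilt m.+1 (B m - Q)].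
  by elim: m => [|m [h1 h2 h3]]; [split | apply: degree_step].
pose p : GS_data R n := fun x => leading (B (size (val x)).-1) (val x).
have pE m : univE (GS_coef p) m.+1 = univE (leading (B m)) m.+1.
  by apply: univE_eq => s ss gs; rewrite /GS_coef insubT /p /= ss.
exists p; apply/GS_procedureE; split; first exact: univA_near.
apply: tfilt_tcvg => N; rewrite GS_partial_univ.
have hE d : filt d (univE (GS_coef p) d : U) by apply: univE_filt.
have <- : adprod (univE (GS_coef p)) N (B N) = b.
  by apply: (adprod_telescope _ hE) => m; rewrite pE.
by apply: adprod_cong; have [] := HB N.
Qed.

(** When the exponents below degree [d] agree, the factors before degree [d] can be
    cancelled, and [b] determines the commutators of the exponent of degree [d] with
    [Q]. Since each word in it has a nonzero weight, its coefficients can be read off. *)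
Lemma GS_procedure_inj p p' : GS_procedure p A = GS_procedure p' A -> p = p'.
Proof.
move=> E; have [b hb hN] := GS_procedure_ex p (univA_near R n).
have [b' hb' hN'] := GS_procedure_ex p' (univA_near R n).
have bb : b' = b by case: (etrans (esym hb') (etrans (esym E) hb)).
subst b'.
have hE q d : filt d (univE (GS_coef q) d : U) by apply: univE_filt.
suff H d s : size s = d -> GS_index s -> GS_coef p s = GS_coef p' s.
  apply/funext => x; have := H _ (val x) erefl (valP x).
  by rewrite /GS_coef valK.
elim/ltn_ind: d s => -[|d] IH s sd gs; first by case: s sd gs.
have := tfilt_trans (hN d.+1) (hN' d.+1).
rewrite !GS_partial_univ !adprodS.
rewrite (@adprod_eq _ _ _ (univE (GS_coef p')) (univE (GS_coef p)) d); last first.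
  by move=> c /andP[_ cd]; apply: univE_eq => t st gt; apply/esym/(IH c).
move/(adprod_inj (hE p))/tfiltBP => hd.
have [_ _ /existsP[k wk]] := and3P gs.
have := tAd_commutators (ltn0Sn d) (hE p d.+1) (hE p' d.+1) (hd k).
move=> /(_ s); rewrite skewBE !univE_comm sd eqxx gs => /(_ (ltnSn _)) /eqP.
rewrite -scalerBl -mulrBr scaler_eq0 mulf_eq0.
have -> : weight s k = true by rewrite ffunE.
rewrite expr1 => /orP[/orP[/eqP|/eqP]|/eqP g0]; [lra|lra|].
have := @cliff_gen_sqr R n k; rewrite g0 mul0r => /eqP.
by rewrite eq_sym oppr_eq0 oner_eq0.
Qed.

End Bijection.

(** * The classification *)

Section Classification.
Variables (R : realType) (n : nat).
Local Notation letter := ('I_n * mindex n)%type.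
Local Notation U := (univ R n).
Local Notation Q := (univQ R n).
Local Notation A := (univA R n).

Lemma diag_univQ (t : letter -> R) v phi k : diag t v phi -> phi (Q k) = (-1) ^+ v k *: Q k.
Proof.
case=> _ hphi; apply/funext => w; rewrite hphi skewZE ffunE; case: w => [|l w].
  by rewrite big_nil scale1r; apply: cliff_twist_gen.
rewrite -[skewC _ _ (l :: w)]/(0 : cliff R n) scaler0.
by rewrite (raddf0 (cliff_twist v)) scaler0.
Qed.

Lemma diag_univX (t : letter -> R) v phi l : diag t v phi -> phi (univX R l) = t l *: univX R l.
Proof.
case=> _ hphi; apply/funext => w; rewrite hphi skewZE /univX /skewX.
case: eqP => [->|_]; last by rewrite (raddf0 (cliff_twist v)) !scaler0.
by rewrite big_seq1 (rmorph1 (cliff_twist v)).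
Qed.

Lemma diag_univA (t : letter -> R) v phi k : diag t v phi ->
  phi (A k) = (-1) ^+ v k *: (Q k + (\sum_(i : mindex n | nonfirst (k, i)) t (k, i) *: univX R (k, i)) * Q k).
Proof.
move=> hphi.
have -> : A k = Q k + (\sum_(i : mindex n | nonfirst (k, i)) univX R (k, i)) * Q k by rewrite !ffunE.
rewrite (raddfD phi) /= (rmorphM phi) /= (raddf_sum phi) /= (diag_univQ k hphi).
rewrite -scalerAr -scalerDr; congr (_ *: (_ + _ * _)); apply: eq_bigr => i _.
exact: diag_univX hphi.
Qed.

Variable Psi : FQop R n.
Hypotheses (orth : FQ_orthogonalization Psi) (vL : FQ_vL Psi) (vC : FQ_vC Psi).

(** The diagonal endomorphisms map [univA] to its sign changes, to itself, or to [Q];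
    naturality turns (vL) and (vC) into properties of the value at [univA]. *)
Lemma Psi_univ : exists b, [/\ Psi A = Some b, clifford b, invariant b & tfilt 1 (b - Q)].
Proof.
have [[dom [natP _] _] cl] := orth.
have := (dom _ A).2 (univA_near R n); case Eb : (Psi A) => [b|] // _.
have AE k : A k = Q k + (\sum_(i : mindex n | nonfirst (k, i)) univX R (k, i)) * Q k by rewrite !ffunE.
exists b; split=> //; first exact: cl Eb.
- apply/invariantP; split=> [v phi hphi k|phi hphi k].
    have E : [ffun k => phi (A k)] = tsign v A.
      apply/ffunP => j; rewrite [LHS]ffunE [RHS]ffunE (diag_univA j hphi) AE.
      by congr (_ *: (_ + _ * _)); apply: eq_bigr => i _; rewrite scale1r.
    have := natP _ _ phi hphi.1 _ _ Eb; rewrite E (vL v Eb) => -[/ffunP/(_ k)].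
    by rewrite [LHS]ffunE [RHS]ffunE => <-.
  have E : [ffun k => phi (A k)] = A.
    apply/ffunP => j; rewrite [LHS]ffunE (diag_univA j hphi) AE ffunE expr0 scale1r.
    by congr (_ + _ * _); apply: eq_bigr => i ->; rewrite scale1r.
  have := natP _ _ phi hphi.1 _ _ Eb; rewrite E Eb => -[/ffunP/(_ k)].
  by rewrite [RHS]ffunE => <-.
(* the endomorphism that kills all the letters maps [univA] to [Q] *)
have [phi hphi] := diag_ex (fun=> 0 : R) (0 : mindex n).
have E : [ffun k => phi (A k)] = Q.
  apply/ffunP => j; rewrite [LHS]ffunE (diag_univA j hphi) big1 ?mul0r ?addr0.
    by rewrite ffunE expr0 scale1r.
  by move=> i _; rewrite scale0r.
have := natP _ _ phi hphi.1 _ _ Eb; rewrite E (vC (@univQ_clifford R n)) => -[/ffunP hb].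
apply/tfiltBP => k [|l w] // _; have := congr1 (fun f : U => f [::]) (hb k).
rewrite [X in _ = X _]ffunE hphi.2 big_nil scale1r cliff_twist0 skewBE => ->.
by rewrite subrr.
Qed.

Lemma classification : exists! p : GS_data R n, GS_procedure p = Psi.
Proof.
have [b [Eb cb inv hb]] := Psi_univ.
have [p hp] := GS_procedure_surj cb inv hb.
have [[dom natP _] _] := orth.
exists p; split=> [|p' hp'].
  apply: FQ_ext => //; [exact: GS_procedure_domain|exact: GS_procedure_natural|].
  exact: etrans hp (esym Eb).
apply: GS_procedure_inj.
by rewrite hp' hp Eb.
Qed.

End Classification.

(** * The number of coefficients *)

Lemma big_tupleS (R : nmodType) (T : finType) r (F : r.+1.-tuple T -> R) :
  \sum_t F t = \sum_x \sum_(t : r.-tuple T) F [tuple of x :: t].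
Proof.
rewrite pair_bigA (reindex (fun z : T * r.-tuple T => [tuple of z.1 :: z.2])) //=.
exists (fun t : r.+1.-tuple T => (thead t, [tuple of behead t])).
  by move=> [x t] _ /=; congr pair; apply: val_inj.
by move=> t _ /=; rewrite [in RHS](tuple_eta t).
Qed.

Section Counting.
Variables (R : realType) (n : nat).
Local Notation letter := ('I_n * mindex n)%type.
Implicit Types (i v : mindex n) (r : nat) (s : seq letter).

Lemma weight_cons (x : letter) s : weight (x :: s) = x.2 + weight s.
Proof. by apply/ffunP => h; rewrite !ffunE big_cons. Qed.

Lemma GS_indexE s : (0 < size s)%N -> GS_index s = all (@nonfirst n) s && (weight s != 0).
Proof.
move=> s0; rewrite /GS_index s0 /=; congr (_ && _).
apply/idP/idP => [/existsP[h hh]|].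
  apply/eqP => E; have := congr1 (fun v : mindex n => v h) E.
  by rewrite !ffunE hh.
apply: contraNT; rewrite negb_exists => /forallP E.
by apply/eqP/ffunP => h; rewrite !ffunE; apply/negbTE/E.
Qed.

(** A nonzero [i] has exactly one first index, and the zero index has none. *)
Lemma sum_nonfirst i : \sum_(k < n) (nonfirst (k, i))%:R = n%:R - 1 + (i == 0)%:R :> R.
Proof.
transitivity (n%:R - \sum_(k < n) (is_first k i)%:R : R).
  rewrite -[n in n%:R]card_ord -sum1_card natr_sum -sumrB; apply: eq_bigr => k _.
  by rewrite /nonfirst /=; case: is_first; rewrite ?subrr ?subr0.
rewrite -addrA; congr (_ + _); case: eqVneq => [->|i0].
  rewrite addrC subrr big1 ?oppr0 // => k _; by rewrite /is_first ffunE.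
rewrite addr0; congr (- _).
have [h ih] : exists h, i h.
  apply/existsP; apply: contraNT i0; rewrite negb_exists => /forallP E.
  by apply/eqP/ffunP => h; rewrite ffunE; apply/negbTE/E.
case: (arg_minnP (fun k : 'I_n => k : nat) ih) => k ik kmin.
rewrite (bigD1 k) //= big1 ?addr0 => [|j jk].
  by rewrite (_ : is_first k i) // /is_first ik; apply/forallP => j; apply/implyP/kmin.
case E: is_first => //; case/andP: E => ij /forallP/(_ k); rewrite ik /= => jlek.
by case/eqP: jk; apply/val_inj/eqP; rewrite eqn_leq jlek kmin.
Qed.

Let total r : R := \sum_(t : r.-tuple letter) (all (@nonfirst n) t)%:R.

Let weighted r v : R :=
  \sum_(t : r.-tuple letter) (all (@nonfirst n) t && (weight t == v))%:R.

Let total_weighted r : \sum_v weighted r v = total r.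
Proof.
rewrite exchange_big; apply: eq_bigr => t _ /=.
rewrite (bigD1 (weight t)) //= eqxx andbT big1 ?addr0 // => v vt.
by rewrite eq_sym (negPf vt) andbF.
Qed.

(** The number of letters [(k, i)] that are not first is [n - 1] for each [i], plus one
    more for [i = 0]: the first part spreads the words evenly over all weights, and the
    additional letter keeps the weight. *)
Let weightedS r v : weighted r.+1 v = (n%:R - 1) * total r + weighted r v.
Proof.
rewrite /weighted big_tupleS.
transitivity (\sum_(k < n) \sum_i (nonfirst (k, i))%:R * weighted r (v - i)).
  rewrite [RHS]pair_bigA; apply: eq_bigr => -[k i] _ /=; rewrite mulr_sumr; apply: eq_bigr => t _.
  rewrite weight_cons /= -andbA -mulnb natrM; congr (_ * (_ && _)%:R).
  by rewrite [RHS]eq_sym subr_eq addrC eq_sym.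
rewrite exchange_big; under eq_bigr do rewrite -mulr_suml sum_nonfirst mulrDl.
rewrite big_split /= -mulr_sumr; congr (_ * _ + _).
  rewrite -total_weighted (reindex_inj (h := fun i => v - i)) /=; last first.
    by move=> i j /addrI /oppr_inj.
  by apply: eq_bigr => i _; rewrite opprB addrC subrK.
rewrite (bigD1 (0 : mindex n)) //= eqxx mul1r subr0 big1 ?addr0 // => i /negPf ->.
by rewrite mul0r.
Qed.

Let totalS r : total r.+1 = ((n%:R - 1) * 2 ^+ n + 1) * total r.
Proof.
rewrite -total_weighted; under eq_bigr do rewrite weightedS.
rewrite big_split /= total_weighted sumr_const card_ffun card_bool card_ord.
by rewrite -[_ *+ (2 ^ n)%N]mulr_natr natrX; ring.
Qed.

Let total0 : total 0 = 1.
Proof. by rewrite /total (big_pred1 [tuple]) // => t; apply/esym/eqP/tuple0. Qed.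

Lemma card_GS_index r : (0 < r)%N ->
  #|[set s : r.-tuple letter | GS_index s]|%:R
  = (((n%:R - 1) * 2 ^+ n + 1) ^+ r - 1) * (1 - 2 ^- n) :> R.
Proof.
move=> r0.
have totalE m : total m = ((n%:R - 1) * 2 ^+ n + 1) ^+ m.
  by elim: m => [|m IH]; [rewrite total0 | rewrite totalS IH exprS].
have p2 : (2 : R) ^+ n != 0 by rewrite expf_neq0 ?pnatr_eq0.
(* the solution of the recurrences [weightedS] and [totalS] *)
have wE m : weighted m 0 = (total m + 2 ^+ n - 1) / 2 ^+ n.
  elim: m => [|m IH].
    rewrite total0 addrC addKr divff // /weighted (big_pred1 [tuple]) /=; last by move=> t; apply/esym/eqP/tuple0.
    by rewrite (_ : weight [::] == 0) //; apply/eqP/ffunP => h; rewrite !ffunE big_nil.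
  by rewrite weightedS IH totalS; field.
transitivity (total r - weighted r 0); last by rewrite wE totalE; field.
rewrite -sum1dep_card natr_sum big_mkcond -sumrB; apply: eq_bigr => t _ /=.
rewrite GS_indexE ?size_tuple //.
by case: all; case: eqP; rewrite ?subrr ?subr0.
Qed.

End Counting.

Theorem theorem4p9 (R : realType) (n : nat) (n_gt0 : (0 < n)%N) :
  [/\ forall p : GS_data R n,
        [/\ FQ_orthogonalization (GS_procedure p),
            FQ_vL (GS_procedure p) & FQ_vC (GS_procedure p)],
      forall Psi : FQop R n,
        FQ_orthogonalization Psi -> FQ_vL Psi -> FQ_vC Psi ->
        exists! p : GS_data R n, GS_procedure p = Psi
    & forall r : nat, (0 < r)%N ->
        #|[set s : r.-tuple ('I_n * mindex n) | GS_index s]|%:R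
        = (((n%:R - 1) * 2 ^+ n + 1) ^+ r - 1) * (1 - 2 ^- n) :> R].
Proof.
split=> [p|Psi orth vL vC|r r0].
- split; [split; last exact: GS_procedure_clifford | exact: GS_procedure_vL | exact: GS_procedure_vC].
  have dom := @GS_procedure_domain R n p; have nat := @GS_procedure_natural R n p.
  by split=> //; apply: natural_analytic.
- exact: classification.
exact: card_GS_index.
Qed.
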